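(* Let $T$ be an equilateral compact metric tree rooted at $v_0$, with all edges of the same length $\ell>0$ and with real-valued potentials $q_j\in L^2(0,\ell)$ on the edges. Then the multiplicity of any eigenvalue $\lambda_0\in\mathrm{Sp}(L_N)$ is equal to the multiplicity of $\lambda_0$ as a zero of the characteristic function $\lambda\mapsto\phi_N(\lambda)=\det\Phi_N(\lambda)$.
   Context: Tree. $T$ is a finite metric tree with $p\ge2$ vertices and $g=p-1$ edges $e_1,\dots,e_g$, all of length $\ell>0$, with a chosen vertex $v_0$ as root; $d(v)$ is the degree of $v$. Edges are directed away from the root and each is identified with $[0,\ell]$, $x=0$ being its initial vertex; each vertex $v\ne v_0$ has exactly one incoming edge. The edges outgoing from $v_0$ are $e_1,\dots,e_{d(v_0)}$. On $e_j$ consider $-y_j''+q_jy_j=\lambda y_j$. Vertex conditions. Standard conditions at $v\neq v_0$ with incoming edge $e_j$: $y_j'(\ell)=0$ if $v$ is pendant; if $v$ is interior, $y_j(\ell)=y_k(0)$ for every edge $e_k$ outgoing from $v$ and $y_j'(\ell)=\sum_k y_k'(0)$, the sum being over edges outgoing from $v$. Standard conditions at $v_0$: $y_1(0)=y_k(0)$ for $k=2,\dots,d(v_0)$ and $\sum_{k=1}^{d(v_0)}y_k'(0)=0$. $L_N$ is the self-adjoint operator $(y_j)\mapsto(-y_j''+q_jy_j)$ in $\bigoplus_{j=1}^gL^2(0,\ell)$ with domain all $(y_j)\in\bigoplus_{j=1}^g H^2(0,\ell)$ satisfying standard conditions at all vertices. The multiplicity of an eigenvalue $\lambda_0$ is $\dim\ker(L_N-\lambda_0)$.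 $\mathrm{Sp}$ denotes the spectrum. Characteristic function. Let $c_j(\sqrt\lambda,x)$, $s_j(\sqrt\lambda,x)$ solve the equation on $e_j$ with $c_j=1,c_j'=0$ and $s_j=0,s_j'=1$ at $x=0$ (they are entire functions of $\lambda$). Writing $y_j=a_jc_j+b_js_j$, the standard conditions at all vertices become a $2g\times2g$ homogeneous linear system for $(a_1,\dots,a_g,b_1,\dots,b_g)^\top$ with matrix $\Phi_N(\lambda)$: the first $d(v_0)$ rows express $a_1-a_2=0,\dots,a_1-a_{d(v_0)}=0$, $b_1+\dots+b_{d(v_0)}=0$, and the remaining rows express the conditions $y_j(\ell)-y_k(0)=0$ and $y_j'(\ell)-\sum_ky_k'(0)=0$ at the vertices $v\neq v_0$ (one row for each outgoing edge, plus one Kirchhoff/Neumann row). The order of rows and of edges affects $\phi_N=\det\Phi_N$ only by a sign. *)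

(* Defs.v *)
From HB Require Import structures.
From mathcomp Require Import all_boot all_order all_algebra.
From mathcomp Require Import all_classical all_reals all_analysis.
From mathcomp Require Import complex.
Set Implicit Arguments.
Unset Strict Implicit.
Unset Printing Implicit Defensive.
Import Order.TTheory GRing.Theory Num.Theory.
Import numFieldNormedType.Exports.
Local Open Scope classical_set_scope.
Local Open Scope ring_scope.

Definition is_tree (V : finType) (adj : rel V) : Prop :=
  [/\ symmetric adj, irreflexive adj, (forall u v, connect adj u v) &
      forall s : seq V, (2 < size s)%N -> cycle adj s -> ~~ uniq s].

Definition edge_adj (V : finType) (g : nat) (src tgt : 'I_g -> V) : rel V :=
  fun u v => [exists j : 'I_g, ((src j == u) && (tgt j == v))
                            || ((src j == v) && (tgt j == u))].

Definition degree (V : finType) (adj : rel V) (v : V) : nat :=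
  #|[set u | adj v u]%SET|.

(* A finite tree with g = n.+1 >= 1 edges (so p = n.+2 vertices) and a chosen
   root.  Edge j goes from [src j] to [tgt j]; [away_from_root] says that
   [src j] precedes [tgt j] on the simple path from the root.  The edges
   outgoing from the root are numbered first, so e_1 is [ord0]. *)
Record rooted_tree (V : finType) (n : nat) := RootedTree {
  root : V;
  src : 'I_n.+1 -> V;
  tgt : 'I_n.+1 -> V;
  tree_edges : is_tree (edge_adj src tgt);
  no_parallel_edges : forall j k : 'I_n.+1,
    [set src j; tgt j]%SET = [set src k; tgt k]%SET -> j = k;
  away_from_root : forall (j : 'I_n.+1) (s : seq V),
    path (edge_adj src tgt) root s -> uniq (root :: s) ->
    last root s = tgt j -> src j \in root :: s;
  root_edges_first : forall j : 'I_n.+1,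
    (src j == root) = (j < degree (edge_adj src tgt) root)%N
}.

Section FunctionSpaces.
Context {R : realType}.
Notation C := (R[i]).
Notation mu := (@lebesgue_measure R).

Definition L2_real (l : R) (f : R -> R) : Prop :=
  measurable_fun `[0, l] f /\
  mu.-integrable `[0, l] (fun x => (f x ^+ 2)%:E).

Definition L2 (l : R) (f : R -> C) : Prop :=
  L2_real l (fun x => complex.Re (f x)) /\ L2_real l (fun x => complex.Im (f x)).

Definition Cintegral (D : set R) (f : R -> C) : C :=
  Complex (\int[mu]_(t in D) complex.Re (f t))
          (\int[mu]_(t in D) complex.Im (f t)).

(* y is the C^1 representative of an element of H^2(0,l), y1 its derivative
   (up to the endpoints) and y2 a representative of its second derivative in
   L^2(0,l): y and y1 are absolutely continuous on [0,l] with a.e. derivatives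
   y1 and y2. *)
Definition H2 (l : R) (y y1 y2 : R -> C) : Prop :=
  [/\ forall x, x \in `[0, l] -> y x = y 0 + Cintegral `[0, x] y1,
      forall x, x \in `[0, l] -> y1 x = y1 0 + Cintegral `[0, x] y2 &
      L2 l y2].

(* y solves - y'' + q y = lambda y on (0,l), in the sense of Caratheodory, with
   y(0) = a and y'(0) = b; y1 is the derivative of y. *)
Definition ivp_solution (l : R) (q : R -> R) (lambda a b : C)
    (y y1 : R -> C) : Prop :=
  [/\ exists2 y2, H2 l y y1 y2 &
        {ae mu, forall x, x \in `[0, l] ->
          - y2 x + (q x)%:C%C * y x = lambda * y x},
      y 0 = a & y1 0 = b].

(* lambda0 is a zero of order m of f: near lambda0, f(z) = (z - lambda0)^m h(z)
   with h holomorphic and h(lambda0) <> 0.  A zero of order 0 is a point where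
   f is holomorphic and does not vanish. *)
Definition zero_multiplicity (f : C -> C) (lambda0 : C) (m : nat) : Prop :=
  exists h : C -> C,
    [/\ \forall z \near (lambda0 : C^o), derivable (h : C^o -> C^o) z 1,
        h lambda0 != 0 &
        \forall z \near (lambda0 : C^o), f z = (z - lambda0) ^+ m * h z].

End FunctionSpaces.

Section Operator.
Context {R : realType} {V : finType} {n : nat}.
Variables (T : rooted_tree V n) (l : R).
Notation C := (R[i]).
Notation mu := (@lebesgue_measure R).
Notation root := (root T).
Notation src := (src T).
Notation tgt := (tgt T).
Notation tuple_fun := ('I_n.+1 -> R -> C).

Definition standard_at_root (y y1 : tuple_fun) : Prop :=
  (forall k, src k = root -> y ord0 0 = y k 0) /\
  \sum_(k | src k == root) y1 k 0 = 0.

(* Here j is the edge incoming into v.  If v is pendant no edge goes out of v,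
   and the condition reduces to y_j'(l) = 0. *)
Definition standard_at (v : V) (y y1 : tuple_fun) : Prop :=
  forall j, tgt j = v ->
    (forall k, src k = v -> y j l = y k 0) /\
    y1 j l = \sum_(k | src k == v) y1 k 0.

Definition L2_eq (y z : tuple_fun) : Prop :=
  forall j, {ae mu, forall x, x \in `[0, l] -> y j x = z j x}.

(* The graph of the operator L_N: y is in its domain and L_N y = f.  Elements
   of the domain are given by their C^1 representatives on [0,l]. *)
Definition LN (q : 'I_n.+1 -> R -> R) (y f : tuple_fun) : Prop :=
  exists y1 y2 : tuple_fun,
    [/\ forall j, H2 l (y j) (y1 j) (y2 j),
        standard_at_root y y1,
        forall v, v != root -> standard_at v y y1 &
        L2_eq (fun j x => - y2 j x + (q j x)%:C%C * y j x) f].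

Definition ker_LN (q : 'I_n.+1 -> R -> R) (lambda : C) (y : tuple_fun) : Prop :=
  LN q y (fun j x => lambda * y j x).

Definition eigenvalue_LN (q : 'I_n.+1 -> R -> R) (lambda : C) : Prop :=
  exists2 y, ker_LN q lambda y & ~ L2_eq y (fun _ _ => 0).

(* dim ker (L_N - lambda) = m: the kernel, as a subspace of L^2 (functions
   modulo a.e. equality), has a basis with m elements. *)
Definition eigenvalue_multiplicity (q : 'I_n.+1 -> R -> R) (lambda : C)
    (m : nat) : Prop :=
  exists u : 'I_m -> tuple_fun,
    [/\ forall i, ker_LN q lambda (u i),
        forall a : 'I_m -> C,
          L2_eq (fun j x => \sum_(i < m) a i * u i j x) (fun _ _ => 0) ->
          forall i, a i = 0 &
        forall y, ker_LN q lambda y ->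
          exists a : 'I_m -> C,
            L2_eq y (fun j x => \sum_(i < m) a i * u i j x)].

(* The system for (a_1..a_g, b_1..b_g).  The upper g rows are indexed by the
   edges k.  If k goes out of the root, row k is b_1 + .. + b_d(v_0) = 0 when k
   is e_1 and a_1 - a_k = 0 otherwise; if k goes out of v <> v_0, row k is
   y_j(l) - y_k(0) = 0, where j is the edge incoming into v = src k.  The lower
   g rows are indexed by the vertices v <> v_0 through their incoming edge i:
   row i is y_i'(l) - sum of y_k'(0) over the edges k out of tgt i. *)
Definition PhiN (c c1 s s1 : 'I_n.+1 -> C -> R -> C) (lambda : C) :
    'M[C]_(n.+1 + n.+1) :=
  block_mx
    (\matrix_(k, j) if src k == root then
                      if k == ord0 then 0 else (j == ord0)%:R - (j == k)%:R
                    else (tgt j == src k)%:R * c j lambda l - (j == k)%:R)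
    (\matrix_(k, j) if src k == root then
                      if k == ord0 then (src j == root)%:R else 0
                    else (tgt j == src k)%:R * s j lambda l)
    (\matrix_(i, j) ((j == i)%:R * c1 j lambda l))
    (\matrix_(i, j) ((j == i)%:R * s1 j lambda l - (src j == tgt i)%:R)).

Definition phiN (c c1 s s1 : 'I_n.+1 -> C -> R -> C) (lambda : C) : C :=
  \det (PhiN c c1 s s1 lambda).

End Operator.

(* Main.v *)
Require Import Defs.
From HB Require Import structures.
From mathcomp Require Import all_boot all_order all_algebra.
From mathcomp Require Import all_classical all_reals all_analysis.
From mathcomp Require Import complex ring lra.
Import Order.TTheory GRing.Theory Num.Theory.
Import measurable_realfun.
Import numFieldNormedType.Exports.
Local Open Scope classical_set_scope.
Local Open Scope ring_scope.
Set Implicit Arguments.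
Unset Strict Implicit.
Unset Printing Implicit Defensive.

(** An eigenvalue has dim ker (L_N - lambda0) = dim ker Phi(lambda0), because on every edge
    a solution is determined by its Cauchy data (a_j, b_j). For an analytic matrix function
    Phi, det Phi vanishes at lambda0 to the order dim ker Phi(lambda0) exactly when there is
    no Jordan chain of length two, that is when Phi(lambda0) v = 0 and
    Phi'(lambda0) v + Phi(lambda0) w = 0 imply v = 0: after a change of basis the factor
    lambda - lambda0 can be taken out of as many rows as the kernel has dimensions, and the
    absence of chains says that the remaining matrix is invertible at lambda0
    ([det_factor], [deflated_unit]).

    Chains are excluded by the symmetry of L_N. If y is the solution with Cauchy data v,
    then its derivative in lambda, corrected by the solution with Cauchy data w, is an edge
    function z that satisfies all vertex conditions and (L_N - lambda0) z = y. As lambda0 is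
    real ([eigenvalue_real]), Green's formula on the tree gives the vanishing of the sum over
    the edges of the integrals of |y_j|^2, so y = 0 ([no_jordan_chain]). Green's formula is
    Lagrange's identity on the edges ([lagrange_identity]) together with the cancellation of
    the boundary terms vertex by vertex ([green_boundary]); the latter rests on the fact that
    every vertex but the root ends exactly one edge ([incoming_edge], [tgt_inj]).

    Analyticity comes from the variation of parameters. For two values of the parameter,
    y_nu = y_lambda + (nu - lambda) G_lambda y_nu, where G_lambda ([green]) is the bounded
    operator that solves the inhomogeneous equation with zero Cauchy data. This gives the
    divided difference of Phi in closed form ([Phi_expand]), and its differentiability, also
    at lambda0, follows from a uniform bound on y_nu ([resolvent_expansion],
    [derivable_pairing]).

    The potentials are only square integrable, so solutions have absolutely continuous
    derivatives and all identities are integrated ones; the product rule for such functions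
    ([primitiveM]) is a consequence of Fubini's theorem. *)

(** * Absolutely continuous functions *)

Section RealPrimitives.
Context {R : realType}.
Notation mu := (@lebesgue_measure R).

Lemma continuous_integrable (l : R) (f : R -> R) :
  {within `[0, l], continuous f} -> mu.-integrable `[0, l] (EFin \o f).
Proof.
move=> cf; apply: continuous_compact_integrable => //.
exact: segment_compact.
Qed.

Lemma L2_real_integrable (l : R) (f : R -> R) :
  L2_real l f -> mu.-integrable `[0, l] (EFin \o f).
Proof.
move=> [mf if2].
have i1 : mu.-integrable `[0, l] (EFin \o (fun=> 1 : R)).
  by apply: continuous_integrable; apply: continuous_subspaceT => x; exact: cvg_cst.
apply: (le_integrable _ _ _ (integrableD _ i1 if2)) => //.
  exact/measurable_EFinP.
move=> x _ /=; rewrite lee_fin [leRHS]ger0_norm; last by rewrite addr_ge0 ?sqr_ge0.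
(* |f| <= 1 + f^2 *)
have := sqr_ge0 (`|f x| - 1); have := sqr_ge0 (f x); rewrite -(real_normK (num_real (f x))).
by set a := `|f x|; nra.
Qed.

Lemma continuous_bounded (l : R) (f : R -> R) : 0 <= l ->
  {within `[0, l], continuous f} ->
  exists2 M, 0 <= M & forall x, x \in `[0, l] -> `|f x| <= M.
Proof.
move=> l0 cf.
have cnf : {within `[0, l], continuous (fun x => `|f x|)}.
  move=> x; apply: (@continuous_comp (subspace `[0, l]) R R f Num.norm).
    exact: cf.
  exact: norm_continuous.
have [c cl H] := EVT_max l0 cnf.
by exists `|f c|.
Qed.

Lemma integrable_mul_continuous (l : R) (f g : R -> R) : 0 <= l ->
  mu.-integrable `[0, l] (EFin \o f) -> {within `[0, l], continuous g} ->
  mu.-integrable `[0, l] (EFin \o (fun x => f x * g x)).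
Proof.
move=> l0 fi cg.
have [M M0 HM] := continuous_bounded l0 cg.
apply: (@integrableMl _ _ _ mu `[0, l]%classic _ (EFin \o f) g) => //.
  by apply: subspace_continuous_measurable_fun.
exists M; split; first exact: num_real.
by move=> K MK x xl; apply: (le_trans _ (ltW MK)); exact: HM.
Qed.

(** Absolute continuity on [0, l], with a chosen representative of the almost everywhere
    derivative: all later identities are stated for the integrals of f'. *)
Definition primitive (l : R) (f f' : R -> R) : Prop :=
  mu.-integrable `[0, l] (EFin \o f') /\
  forall x, x \in `[0, l] -> f x = f 0 + \int[mu]_(t in `[0, x]) f' t.

Lemma primitive_continuous (l : R) (f f' : R -> R) : 0 <= l ->
  primitive l f f' -> {within `[0, l], continuous f}.
Proof.
move=> l0 [fi H].
apply: (@subspace_eq_continuous _ _ _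
  (fun x => f 0 + parameterized_integral mu 0 x f' : R)).
  by move=> x; rewrite inE => xl; rewrite [RHS]H.
by move=> x; apply: cvgD; [exact: cvg_cst|exact: parameterized_integral_continuous].
Qed.

Lemma integrable_prefix (l x : R) (f : R -> R) : x \in `[0, l] ->
  mu.-integrable `[0, l] (EFin \o f) -> mu.-integrable `[0, x] (EFin \o f).
Proof.
rewrite in_itv /= => /andP[_ xl]; apply: integrableS => //.
by apply: subset_itvl; rewrite bnd_simp.
Qed.

Lemma integrable_tensor (F G : R -> R) :
  mu.-integrable setT (EFin \o F) -> mu.-integrable setT (EFin \o G) ->
  (mu \x mu)%E.-integrable setT (fun z : R * R => (F z.1 * G z.2)%:E).
Proof.
move=> iF iG.
have mF : measurable_fun setT F by case/integrableP : iF => /measurable_EFinP.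
have mG : measurable_fun setT G by case/integrableP : iG => /measurable_EFinP.
apply/integrable12ltyP.
  apply/measurable_EFinP; apply: measurable_funM.
    by apply: (measurableT_comp mF); exact: measurable_fst.
  by apply: (measurableT_comp mG); exact: measurable_snd.
have [_ bF] := integrableP _ _ _ iF.
have [_ bG] := integrableP _ _ _ iG.
under eq_integral => x _.
  under eq_integral => y _ do rewrite /= normrM EFinM.
  rewrite ge0_integralZl//=; last first.
    by apply/measurable_EFinP; exact: measurableT_comp.
  over.
rewrite /= ge0_integralZr//=.
- by apply: lte_mul_pinfty => //; rewrite ?integral_ge0// ge0_fin_numE// integral_ge0.
- by apply/measurable_EFinP; exact: measurableT_comp.
- exact: integral_ge0.
Qed.

Lemma patch_segmentE (a b y : R) (f : R -> R) :
  (f \_ `[a, b]) y = if a <= y <= b then f y else 0.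
Proof.
rewrite patchE; case: ifPn => [|/negP ny]; first by rewrite inE /= in_itv /= => ->.
by case: ifPn => // yab; case: ny; rewrite inE /= in_itv.
Qed.

(** Both sides are the integral of f(s) g(t) over the triangle 0 <= s <= t <= x. *)
Lemma triangle_fubini (x : R) (f g : R -> R) :
  mu.-integrable `[0, x] (EFin \o f) -> mu.-integrable `[0, x] (EFin \o g) ->
  \int[mu]_(s in `[0, x]) (f s * \int[mu]_(t in `[s, x]) g t) =
  \int[mu]_(t in `[0, x]) ((\int[mu]_(s in `[0, t]) f s) * g t).
Proof.
move=> fi gi.
pose F := f \_ `[0, x]; pose G := g \_ `[0, x].
have iF : mu.-integrable setT (EFin \o F).
  by rewrite -restrict_EFin -integrable_mkcond.
have iG : mu.-integrable setT (EFin \o G).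
  by rewrite -restrict_EFin -integrable_mkcond.
pose h (z : R * R) := F z.1 * G z.2 * (z.1 <= z.2)%R%:R.
have iT := integrable_tensor iF iG.
have mT : measurable_fun setT (fun z : R * R => F z.1 * G z.2).
  by case/integrableP : iT => /measurable_EFinP.
have mh : measurable_fun setT h.
  apply: measurable_funM => //.
  have -> : (fun z : R * R => (z.1 <= z.2)%R%:R : R) =
            (fun z => if z.1 <= z.2 then 1 else 0).
    by apply/funext => z; case: ifP.
  apply: measurable_fun_ifT => //.
  by apply: measurable_fun_ler; [exact: measurable_fst|exact: measurable_snd].
have ih : (mu \x mu)%E.-integrable setT (EFin \o h).
  apply: (le_integrable _ _ _ iT) => //; first exact/measurable_EFinP.
  move=> z _ /=; rewrite lee_fin /h; case: (z.1 <= z.2); first by rewrite mulr1.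
  by rewrite mulr0 normr0.
have := Fubini ih.
rewrite /Rintegral => fub; congr fine; rewrite integral_mkcond [RHS]integral_mkcond.
transitivity (\int[mu]_s \int[mu]_t (EFin \o h) (s, t))%E.
  apply: eq_integral => s _; rewrite restrict_EFin /= /h /= patch_segmentE.
  case: ifPn => [/andP[s0 sx]|snx]; last first.
    by under eq_integral => t _ do rewrite /F patch_segmentE (negPf snx) !mul0r; rewrite integral0.
  have gis : mu.-integrable `[s, x] (EFin \o g).
    apply: (integrableS _ _ _ gi); [exact: measurable_itv|exact: measurable_itv|].
    by apply: subset_itvr; rewrite bnd_simp.
  rewrite EFinM fineK; last exact: integrable_fin_num.
  rewrite integral_mkcond -integralZl; [|exact: measurableT|by rewrite -integrable_mkcond].
  apply: eq_integral => t _.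
  rewrite restrict_EFin /= /F /G !patch_segmentE -EFinM; congr EFin.
  rewrite s0 sx -mulrA; congr (_ * _).
  case: (leP s t) => st /=; last by rewrite mulr0.
  by rewrite (le_trans s0 st) mulr1.
rewrite fub.
apply: eq_integral => t _; rewrite restrict_EFin /= /h /= patch_segmentE.
case: ifPn => [/andP[t0 tx]|tnx]; last first.
  under eq_integral => s _ do rewrite /G patch_segmentE (negPf tnx) mulr0 mul0r.
  by rewrite integral0.
have fis : mu.-integrable `[0, t] (EFin \o f).
  apply: (integrableS _ _ _ fi); [exact: measurable_itv|exact: measurable_itv|].
  by apply: subset_itvl; rewrite bnd_simp.
rewrite EFinM fineK; last exact: integrable_fin_num.
rewrite [in RHS]integral_mkcond -integralZr; [|exact: measurableT|by rewrite -integrable_mkcond].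
apply: eq_integral => s _.
rewrite restrict_EFin /= /F /G !patch_segmentE -EFinM; congr EFin.
rewrite t0 tx mulrAC; congr (_ * _).
case: (leP s t) => st /=; last by rewrite mulr0 andbF.
by rewrite (le_trans st tx) andbT mulr1.
Qed.

(** In [triangle_fubini] for f' and g' the inner integrals are g(x) - g(s) and
    f(t) - f(0); expanding gives integration by parts. *)
Lemma primitiveM (l : R) (f f' g g' : R -> R) : 0 <= l ->
  primitive l f f' -> primitive l g g' ->
  primitive l (fun x => f x * g x) (fun x => f' x * g x + f x * g' x).
Proof.
move=> l0 pf pg.
have cf := primitive_continuous l0 pf; have cg := primitive_continuous l0 pg.
case: pf pg => fi Hf [gi Hg].
have i1 := integrable_mul_continuous l0 fi cg.
have i2 := integrable_mul_continuous l0 gi cf.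
split.
  have -> : EFin \o (fun x => f' x * g x + f x * g' x) =
      ((EFin \o (fun x => (f' x * g x)%R)) \+ (EFin \o (fun x => (g' x * f x)%R)))%E.
    by apply/funext => x /=; rewrite [f x * _]mulrC.
  exact: integrableD.
move=> x xl.
have ifx := integrable_prefix xl fi; have igx := integrable_prefix xl gi.
have i1x := integrable_prefix xl i1; have i2x := integrable_prefix xl i2.
have x0 : 0 <= x by move: xl; rewrite in_itv /= => /andP[].
have sub t : t \in `[0, x] -> t \in `[0, l].
  move: xl; rewrite !in_itv /= => /andP[_ xl] /andP[-> tx] /=; exact: le_trans tx xl.
have := triangle_fubini ifx igx.
have -> : \int[mu]_(s in `[0, x]) (f' s * \int[mu]_(t in `[s, x]) g' t) =
    \int[mu]_(s in `[0, x]) (f' s * g x - f' s * g s).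
  apply: eq_Rintegral => s; rewrite inE /= => sx; rewrite -mulrBr; congr (_ * _).
  rewrite (Hg _ xl) (Hg _ (sub _ sx)) opprD addrACA subrr add0r.
  have sx' := sx; move: sx'; rewrite in_itv /= => /andP[s0 slex].
  rewrite Rintegral_itvB ?bnd_simp//.
  rewrite Rintegral_itv_obnd_cbnd//; apply: integrableS igx => //.
  by apply: subset_itv; rewrite bnd_simp.
have -> : \int[mu]_(t in `[0, x]) ((\int[mu]_(s in `[0, t]) f' s) * g' t) =
    \int[mu]_(t in `[0, x]) (g' t * f t - f 0 * g' t).
  apply: eq_Rintegral => t; rewrite inE /= => tx.
  by rewrite (Hf _ (sub _ tx)); ring.
have i3 : mu.-integrable `[0, x] (EFin \o (fun t => f 0 * g' t)).
  exact: (integrableZl _ (f 0) igx).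
have i4 : mu.-integrable `[0, x] (EFin \o (fun t => f' t * g x)).
  exact: (integrableZr _ (g x) ifx).
rewrite !RintegralB// RintegralZl// RintegralZr//.
have -> : \int[mu]_(t in `[0, x]) (f' t * g t + f t * g' t) =
    \int[mu]_(t in `[0, x]) (f' t * g t) + \int[mu]_(t in `[0, x]) (g' t * f t).
  by rewrite -RintegralD//; apply: eq_Rintegral => t _; rewrite [f t * _]mulrC.
move: (Hf _ xl) (Hg _ xl).
set a := \int[mu]_(t in `[0, x]) f' t; set b := \int[mu]_(t in `[0, x]) g' t.
set u := \int[mu]_(t in `[0, x]) (f' t * g t).
set v := \int[mu]_(t in `[0, x]) (g' t * f t).
by move=> -> ->; lra.
Qed.

Lemma primitiveD (l : R) (f f' g g' : R -> R) :
  primitive l f f' -> primitive l g g' ->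
  primitive l (fun x => f x + g x) (fun x => f' x + g' x).
Proof.
move=> [fi Hf] [gi Hg]; split.
  by apply: (integrableD _ fi gi); exact: measurable_itv.
move=> x xl.
have fx := integrable_prefix xl fi; have gx := integrable_prefix xl gi.
by rewrite RintegralD// (Hf _ xl) (Hg _ xl); ring.
Qed.

Lemma primitive_cst (l a : R) : primitive l (fun=> a) (fun=> 0).
Proof.
split; first exact: integrable0.
by move=> x xl; rewrite Rintegral_cst// mul0r addr0.
Qed.

End RealPrimitives.

Section AlmostEverywhere.
Context {R : realType}.
Notation mu := (@lebesgue_measure R).

Lemma ae_imply (P Q : R -> Prop) : (forall x, P x -> Q x) ->
  {ae mu, forall x, P x} -> {ae mu, forall x, Q x}.
Proof.
have F : Filter (almost_everywhere mu) := ae_filter_ringOfSetsType _.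
move=> PQ; exact: (@filterS _ _ F).
Qed.

Lemma ae_imply2 (P Q S : R -> Prop) : (forall x, P x -> Q x -> S x) ->
  {ae mu, forall x, P x} -> {ae mu, forall x, Q x} -> {ae mu, forall x, S x}.
Proof.
have F : Filter (almost_everywhere mu) := ae_filter_ringOfSetsType _.
move=> PQ; exact: (@filterS2 _ _ F).
Qed.

Lemma ae_segment_point (l : R) (P : R -> Prop) : 0 < l ->
  {ae mu, forall x, x \in `[0, l] -> P x} -> exists2 x, x \in `[0, l] & P x.
Proof.
move=> l0 [N [mN N0 HN]]; apply: contrapT => nP.
have sub : `[0, l]%classic `<=` N.
  by move=> x /= xl; apply: HN => /= /(_ xl) Px; apply: nP; exists x.
have : (mu `[0%R, l]%classic <= mu N)%E by apply: le_measure; rewrite ?inE.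
by rewrite lebesgue_measure_itv/= lte_fin l0 N0 -EFinB lee_fin subr0 leNgt l0.
Qed.

Lemma integral_ae0 (l x : R) (f : R -> R) : x \in `[0, l] ->
  mu.-integrable `[0, l] (EFin \o f) ->
  {ae mu, forall t, t \in `[0, l] -> f t = 0} ->
  \int[mu]_(t in `[0, x]) f t = 0.
Proof.
move=> xl /(integrable_prefix xl) fi f0.
rewrite /Rintegral (@ae_eq_integral _ _ _ mu _ (cst 0%E)) ?integral0//.
  by case/integrableP : fi.
apply: ae_imply f0 => t + /= tx; rewrite in_itv /= => -> //.
move: xl tx; rewrite !in_itv /= => /andP[_ xl] /andP[-> tx]; exact: le_trans xl.
Qed.

(** (f^2)' = 2 f f' vanishes almost everywhere, so f^2 is constant. *)
Lemma primitive_ae0 (l : R) (f f' : R -> R) : 0 < l -> primitive l f f' ->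
  {ae mu, forall x, x \in `[0, l] -> f x = 0} ->
  forall x, x \in `[0, l] -> f x = 0.
Proof.
move=> l0 pf f0.
have [ii Hf2] := primitiveM (ltW l0) pf pf.
have c x : x \in `[0, l] -> f x * f x = f 0 * f 0.
  move=> xl; rewrite Hf2// (integral_ae0 xl ii) ?addr0//.
  by apply: ae_imply f0 => t + /= tl => /(_ tl) ->; rewrite mulr0 mul0r addr0.
have [y yl fy] := ae_segment_point l0 f0.
move=> x xl; have := c x xl; rewrite -(c y yl) fy mulr0 => /eqP.
by rewrite mulf_eq0 => /orP[] /eqP.
Qed.

Lemma primitive_int_sqr0 (l : R) (f f' : R -> R) : 0 < l -> primitive l f f' ->
  \int[mu]_(t in `[0, l]) (f t * f t) = 0 ->
  forall x, x \in `[0, l] -> f x = 0.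
Proof.
move=> l0 pf I0; apply: (primitive_ae0 l0 pf).
have cf := primitive_continuous (ltW l0) (primitiveM (ltW l0) pf pf).
have ff := continuous_integrable cf.
have mf : measurable_fun `[0, l] (EFin \o (fun t => f t * f t)) by case/integrableP : ff.
have : ae_eq mu `[0, l]%classic (EFin \o (fun t => f t * f t)) (cst 0%E).
  apply/(ae_eq_integral_abs mu _ mf) => //.
  have -> : (\int[mu]_(x in `[0%R, l]) `|(EFin \o (fun t => (f t * f t)%R)) x| =
      \int[mu]_(x in `[0%R, l]) (f x * f x)%:E)%E.
    by apply: eq_integral => x _ /=; rewrite ger0_norm// -expr2 sqr_ge0.
  by rewrite -[LHS]fineK ?integrable_fin_num//; congr EFin.
apply: ae_imply => x H xl; have := H xl => -[] /eqP.
by rewrite mulf_eq0 => /orP[] /eqP.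
Qed.

(** As (f f')' = f'^2 + f f'', the vanishing of f makes the integral of f'^2 vanish. *)
Lemma primitive_derivative0 (l : R) (f f' f'' : R -> R) : 0 < l ->
  primitive l f f' -> primitive l f' f'' ->
  (forall x, x \in `[0, l] -> f x = 0) ->
  forall x, x \in `[0, l] -> f' x = 0.
Proof.
move=> l0 pf pf' f0; apply: (primitive_int_sqr0 l0 pf').
have [_ H] := primitiveM (ltW l0) pf pf'.
have l00 : l \in `[0, l] by rewrite in_itv /= lexx ltW.
have z0 : 0 \in `[0, l] by rewrite in_itv /= lexx ltW.
have := H l l00; rewrite !f0// !mul0r add0r => /esym; apply: etrans.
apply: eq_Rintegral => t; rewrite inE /= => tl.
by rewrite f0// mul0r addr0.
Qed.

End AlmostEverywhere.

(** * Complex-valued functions *)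

Section ComplexPrimitives.
Context {R : realType}.
Notation mu := (@lebesgue_measure R).
Notation C := R[i].
Notation Rep := (@complex.Re R).
Notation Imp := (@complex.Im R).

Lemma RepD (x y : C) : Rep (x + y) = Rep x + Rep y.
Proof. by case: x; case: y. Qed.

Lemma ImpD (x y : C) : Imp (x + y) = Imp x + Imp y.
Proof. by case: x; case: y. Qed.

Lemma RepM (x y : C) : Rep (x * y) = Rep x * Rep y - Imp x * Imp y.
Proof. by case: x; case: y. Qed.

Lemma ImpM (x y : C) : Imp (x * y) = Rep x * Imp y + Imp x * Rep y.
Proof. by case: x; case: y. Qed.

Lemma RepN (x : C) : Rep (- x) = - Rep x. Proof. by case: x. Qed.

Lemma ImpN (x : C) : Imp (- x) = - Imp x. Proof. by case: x. Qed.

Lemma Rep_conj (x : C) : Rep (x^*)%C = Rep x. Proof. by case: x. Qed.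

Lemma Imp_conj (x : C) : Imp (x^*)%C = - Imp x. Proof. by case: x. Qed.

Lemma complex_ext (x y : C) : Rep x = Rep y -> Imp x = Imp y -> x = y.
Proof. by case: x; case: y => a b c d /= -> ->. Qed.

Definition Cintegrable (l : R) (f : R -> C) : Prop :=
  mu.-integrable `[0, l] (EFin \o (fun x => Rep (f x))) /\
  mu.-integrable `[0, l] (EFin \o (fun x => Imp (f x))).

Definition Ccontinuous (l : R) (f : R -> C) : Prop :=
  {within `[0, l], continuous (fun x => Rep (f x))} /\
  {within `[0, l], continuous (fun x => Imp (f x))}.

Definition Cprimitive (l : R) (f f' : R -> C) : Prop :=
  primitive l (fun x => Rep (f x)) (fun x => Rep (f' x)) /\
  primitive l (fun x => Imp (f x)) (fun x => Imp (f' x)).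

Lemma primitive_ext (l : R) (f f' g g' : R -> R) :
  f =1 g -> f' =1 g' -> primitive l f f' -> primitive l g g'.
Proof. by move=> /funext -> /funext ->. Qed.

Lemma primitiveN (l : R) (f f' : R -> R) :
  primitive l f f' -> primitive l (fun x => - f x) (fun x => - f' x).
Proof.
move=> [fi H]; split.
  have -> : EFin \o (fun x => - f' x) = (fun x => (- (EFin \o f') x)%E) by [].
  exact: integrableN.
move=> x xl; rewrite H// opprD; congr (_ + _).
have fx := integrable_prefix xl fi.
rewrite -mulN1r -RintegralZl//.
by apply: eq_Rintegral => t _; rewrite mulN1r.
Qed.

Lemma Cprimitive_cst (l : R) (a : C) : Cprimitive l (fun=> a) (fun=> 0).
Proof. by split; exact: primitive_cst. Qed.

Lemma CprimitiveD (l : R) (f f' g g' : R -> C) :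
  Cprimitive l f f' -> Cprimitive l g g' ->
  Cprimitive l (fun x => f x + g x) (fun x => f' x + g' x).
Proof.
move=> [f1 f2] [g1 g2]; split.
- by apply: primitive_ext (primitiveD f1 g1) => x; rewrite RepD.
- by apply: primitive_ext (primitiveD f2 g2) => x; rewrite ImpD.
Qed.

Lemma CprimitiveM (l : R) (f f' g g' : R -> C) : 0 <= l ->
  Cprimitive l f f' -> Cprimitive l g g' ->
  Cprimitive l (fun x => f x * g x) (fun x => f' x * g x + f x * g' x).
Proof.
move=> l0 [f1 f2] [g1 g2]; split.
- apply: primitive_ext (primitiveD (primitiveM l0 f1 g1)
    (primitiveN (primitiveM l0 f2 g2))) => x; first by rewrite RepM.
  by rewrite RepD !RepM; ring.
- apply: primitive_ext (primitiveD (primitiveM l0 f1 g2)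
    (primitiveM l0 f2 g1)) => x; first by rewrite ImpM.
  by rewrite ImpD !ImpM; ring.
Qed.

Lemma Cprimitive_conj (l : R) (f f' : R -> C) : Cprimitive l f f' ->
  Cprimitive l (fun x => (f x)^*%C) (fun x => (f' x)^*%C).
Proof.
move=> [f1 f2]; split.
- by apply: primitive_ext f1 => x; rewrite Rep_conj.
- by apply: primitive_ext (primitiveN f2) => x; rewrite Imp_conj.
Qed.

Lemma CprimitiveB (l : R) (f f' g g' : R -> C) :
  Cprimitive l f f' -> Cprimitive l g g' ->
  Cprimitive l (fun x => f x - g x) (fun x => f' x - g' x).
Proof.
move=> [f1 f2] [g1 g2]; split.
- by apply: primitive_ext (primitiveD f1 (primitiveN g1)) => x; rewrite RepD RepN.
- by apply: primitive_ext (primitiveD f2 (primitiveN g2)) => x; rewrite ImpD ImpN.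
Qed.

Lemma Cprimitive_continuous (l : R) (f f' : R -> C) : 0 <= l ->
  Cprimitive l f f' -> Ccontinuous l f.
Proof. by move=> l0 [f1 f2]; split; apply: primitive_continuous; eassumption. Qed.

Lemma Cprimitive_eq (l x : R) (f f' : R -> C) : Cprimitive l f f' ->
  x \in `[0, l] -> f x = f 0 + Cintegral `[0, x] f'.
Proof.
move=> [[_ f1] [_ f2]] xl.
by apply: complex_ext; [rewrite RepD; exact: f1|rewrite ImpD; exact: f2].
Qed.

Lemma Ccontinuous_integrable (l : R) (f : R -> C) :
  Ccontinuous l f -> Cintegrable l f.
Proof. by move=> [f1 f2]; split; exact: continuous_integrable. Qed.

Lemma Cprimitive_Cintegral (l : R) (f : R -> C) : 0 <= l ->
  Cintegrable l f -> Cprimitive l (fun x => Cintegral `[0, x] f) f.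
Proof.
move=> l0 [f1 f2]; split; split=> // x xl /=; rewrite set_itv1 Rintegral_set1 add0r//.
Qed.

Lemma Cintegral00 (f : R -> C) : Cintegral `[0, 0] f = 0.
Proof. by apply: complex_ext; rewrite /= set_itv1 Rintegral_set1. Qed.

(** Turns an identity between derivatives, which a differential equation provides only
    almost everywhere, into one that holds at every point. *)
Lemma Cprimitive_ae_eq (l : R) (f f' g g' : R -> C) :
  Cprimitive l f f' -> Cprimitive l g g' ->
  {ae mu, forall x, x \in `[0, l] -> f' x = g' x} ->
  forall x, x \in `[0, l] -> f x - f 0 = g x - g 0.
Proof.
move=> pf pg fg x xl.
have [[i1 H1] [i2 H2]] := CprimitiveB pf pg.
have E : f x - g x = f 0 - g 0.
  apply: complex_ext.
    rewrite H1// (integral_ae0 xl i1) ?addr0//.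
    by apply: ae_imply fg => t + tl => /(_ tl) ->; rewrite subrr.
  rewrite H2// (integral_ae0 xl i2) ?addr0//.
  by apply: ae_imply fg => t + tl => /(_ tl) ->; rewrite subrr.
apply/eqP; rewrite subr_eq addrAC eq_sym subr_eq eq_sym; apply/eqP.
have -> : f x = f x - g x + g x by rewrite subrK.
by rewrite E; ring.
Qed.

Lemma Cintegral_eq (x : R) (f g : R -> C) :
  (forall t, t \in `[0, x] -> f t = g t) ->
  Cintegral `[0, x] f = Cintegral `[0, x] g.
Proof.
by move=> fg; apply: complex_ext => /=; apply: eq_Rintegral => t; rewrite inE /= => tx;
  rewrite fg.
Qed.

Lemma CintegralD (l x : R) (f g : R -> C) : x \in `[0, l] ->
  Cintegrable l f -> Cintegrable l g ->
  Cintegral `[0, x] (fun t => f t + g t) = Cintegral `[0, x] f + Cintegral `[0, x] g.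
Proof.
move=> xl [f1 f2] [g1 g2].
have f1x := integrable_prefix xl f1; have f2x := integrable_prefix xl f2.
have g1x := integrable_prefix xl g1; have g2x := integrable_prefix xl g2.
apply: complex_ext; rewrite ?RepD ?ImpD /= -RintegralD//.
  by apply: eq_Rintegral => t _; rewrite RepD.
by apply: eq_Rintegral => t _; rewrite ImpD.
Qed.

Lemma CintegralZ (l x : R) (a : C) (f : R -> C) : x \in `[0, l] ->
  Cintegrable l f ->
  Cintegral `[0, x] (fun t => a * f t) = a * Cintegral `[0, x] f.
Proof.
move=> xl [f1 f2].
have f1x := integrable_prefix xl f1; have f2x := integrable_prefix xl f2.
have iz r h : mu.-integrable `[0, x] (EFin \o h) ->
    mu.-integrable `[0, x] (EFin \o (fun t => r * h t)).
  by move=> hi; exact: (integrableZl _ r hi).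
have a1 := iz (Rep a) _ f1x; have a2 := iz (Imp a) _ f2x.
have a3 := iz (Rep a) _ f2x; have a4 := iz (Imp a) _ f1x.
apply: complex_ext; rewrite ?RepM ?ImpM /= -!RintegralZl//.
  by rewrite -RintegralB//; apply: eq_Rintegral => t _; rewrite RepM.
by rewrite -RintegralD//; apply: eq_Rintegral => t _; rewrite ImpM.
Qed.

Lemma Ccontinuous_cst (l : R) (a : C) : Ccontinuous l (fun=> a).
Proof. by split; apply: continuous_subspaceT => x; exact: cvg_cst. Qed.

Lemma CcontinuousD (l : R) (f g : R -> C) : Ccontinuous l f -> Ccontinuous l g ->
  Ccontinuous l (fun x => f x + g x).
Proof.
move=> [f1 f2] [g1 g2]; split.
- have -> : (fun x => Rep (f x + g x)) = (fun x => Rep (f x) + Rep (g x)).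
    by apply/funext => x; rewrite RepD.
  by move=> x; apply: cvgD; [exact: f1|exact: g1].
- have -> : (fun x => Imp (f x + g x)) = (fun x => Imp (f x) + Imp (g x)).
    by apply/funext => x; rewrite ImpD.
  by move=> x; apply: cvgD; [exact: f2|exact: g2].
Qed.

Lemma CcontinuousM (l : R) (f g : R -> C) : Ccontinuous l f -> Ccontinuous l g ->
  Ccontinuous l (fun x => f x * g x).
Proof.
move=> [f1 f2] [g1 g2]; split.
- have -> : (fun x => Rep (f x * g x)) =
      (fun x => Rep (f x) * Rep (g x) - Imp (f x) * Imp (g x)).
    by apply/funext => x; rewrite RepM.
  by move=> x; apply: cvgB; apply: cvgM; [exact: f1|exact: g1|exact: f2|exact: g2].
- have -> : (fun x => Imp (f x * g x)) =
      (fun x => Rep (f x) * Imp (g x) + Imp (f x) * Rep (g x)).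
    by apply/funext => x; rewrite ImpM.
  by move=> x; apply: cvgD; apply: cvgM; [exact: f1|exact: g2|exact: f2|exact: g1].
Qed.

Notation normc := (@Normc.normc R).

Lemma normcE (z : C) : `|z| = (normc z)%:C%C. Proof. by []. Qed.

Lemma normc_ge0 (z : C) : 0 <= normc z.
Proof. by case: z => a b /=; exact: sqrtr_ge0. Qed.

Lemma normcD (x y : C) : normc (x + y) <= normc x + normc y.
Proof. by have := ler_normD x y; rewrite !normcE -rmorphD lecR. Qed.

Lemma normcM (x y : C) : normc (x * y) = normc x * normc y.
Proof. exact: Normc.normcM. Qed.

Lemma normcN (x : C) : normc (- x) = normc x.
Proof. by case: x => a b /=; rewrite !sqrrN. Qed.

Lemma normc_sqr (z : C) : normc z ^+ 2 = Rep z ^+ 2 + Imp z ^+ 2.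
Proof. by case: z => a b /=; rewrite sqr_sqrtr// addr_ge0// sqr_ge0. Qed.

Lemma normRep_le (z : C) : `|Rep z| <= normc z.
Proof.
rewrite -(@ler_pXn2r _ 2) ?nnegrE ?normc_ge0// normc_sqr real_normK ?num_real//.
by rewrite lerDl sqr_ge0.
Qed.

Lemma normImp_le (z : C) : `|Imp z| <= normc z.
Proof.
rewrite -(@ler_pXn2r _ 2) ?nnegrE ?normc_ge0// normc_sqr real_normK ?num_real//.
by rewrite lerDr sqr_ge0.
Qed.

Lemma normc_le (z : C) : normc z <= `|Rep z| + `|Imp z|.
Proof.
rewrite -(@ler_pXn2r _ 2) ?nnegrE ?normc_ge0 ?addr_ge0// normc_sqr.
rewrite -(real_normK (num_real (Rep z))) -(real_normK (num_real (Imp z))).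
by rewrite sqrrD addrAC lerDl mulrn_wge0// mulr_ge0.
Qed.

Lemma Ccontinuous_max (l : R) (f : R -> C) : 0 <= l -> Ccontinuous l f ->
  exists2 c, c \in `[0, l] & forall x, x \in `[0, l] -> normc (f x) <= normc (f c).
Proof.
move=> l0 [f1 f2].
have cn : {within `[0, l], continuous (fun x => Rep (f x) * Rep (f x) + Imp (f x) * Imp (f x))}.
  by move=> x; apply: cvgD; apply: cvgM; [exact: f1|exact: f1|exact: f2|exact: f2].
have [c cl H] := EVT_max l0 cn; exists c => // x xl.
rewrite -(@ler_pXn2r _ 2) ?nnegrE ?normc_ge0// !normc_sqr !expr2; exact: H.
Qed.

Lemma Cintegral_bound (l x M : R) (f : R -> C) : x \in `[0, l] -> Cintegrable l f ->
  (forall t, t \in `[0, l] -> normc (f t) <= M) ->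
  normc (Cintegral `[0, x] f) <= 2 * (l * M).
Proof.
move=> xl [f1 f2] fM.
have M0 : 0 <= M by apply: le_trans (fM _ xl); exact: normc_ge0.
have /andP[x0 xlel] : 0 <= x <= l by move: xl; rewrite in_itv.
have bound h : mu.-integrable `[0, l] (EFin \o h) ->
    (forall t, t \in `[0, l] -> `|h t| <= M) ->
    `|\int[mu]_(t in `[0, x]) h t| <= l * M.
  move=> /(integrable_prefix xl) hx hM.
  have cx : mu.-integrable `[0, x] (EFin \o (fun=> M)).
    by apply: continuous_integrable; apply: continuous_subspaceT => ?; exact: cvg_cst.
  apply: (le_trans (le_normr_Rintegral _ hx)) => //.
  apply: (@le_trans _ _ (\int[mu]_(t in `[0, x]) M)).
    apply: le_Rintegral => //.
      have -> : EFin \o (fun t => `|h t|) = (abse \o (EFin \o h)) by [].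
      exact: integrable_abse.
    move=> t /=; rewrite in_itv /= => /andP[t0 tx]; apply: hM.
    by rewrite in_itv /= t0 (le_trans tx).
  have mx : fine (mu `[0, x]%classic) = x.
    rewrite lebesgue_measure_itv/= lte_fin; case: ltP => /=; first by rewrite subr0.
    by move=> xle0; apply/le_anti; rewrite x0 xle0.
  by rewrite Rintegral_cst// mx mulrC ler_wpM2r.
apply: (le_trans (normc_le _)); rewrite mulrDl mul1r /=.
apply: lerD; apply: bound => // t tl; apply: le_trans (fM t tl).
  exact: normRep_le.
exact: normImp_le.
Qed.

End ComplexPrimitives.

(** * The Sobolev space H^2 *)

Section SobolevSpace.
Context {R : realType}.
Notation mu := (@lebesgue_measure R).
Notation C := R[i].

Lemma L2_realD (l : R) (f g : R -> R) :
  L2_real l f -> L2_real l g -> L2_real l (fun x => f x + g x).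
Proof.
move=> [mf f2] [mg g2]; have mfg : measurable_fun `[0, l] (fun x => f x + g x).
  exact: measurable_funD.
split=> //.
have i2 : mu.-integrable `[0, l] (fun x => (2%:E * ((f x ^+ 2)%:E + (g x ^+ 2)%:E))%E).
  by apply: integrableZl => //; exact: integrableD.
apply: (le_integrable _ _ _ i2) => //.
  by apply/measurable_EFinP; exact: measurable_funX.
move=> x _ /=; rewrite lee_fin ger0_norm ?sqr_ge0// ger0_norm; last first.
  by rewrite mulr_ge0// addr_ge0 ?sqr_ge0.
by have := sqr_ge0 (f x - g x); rewrite !expr2; nra.
Qed.

Lemma L2_realZ (l a : R) (f : R -> R) : L2_real l f -> L2_real l (fun x => a * f x).
Proof.
move=> [mf f2]; split; first exact: measurable_funM.
have -> : (fun x => ((a * f x) ^+ 2)%:E) = (fun x => ((a ^+ 2)%:E * (f x ^+ 2)%:E)%E).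
  by apply/funext => x; rewrite exprMn EFinM.
by apply: (integrableZl _ (a ^+ 2) f2); exact: measurable_itv.
Qed.

Lemma L2_comb (l : R) (a b : C) (f g : R -> C) :
  L2 l f -> L2 l g -> L2 l (fun x => a * f x + b * g x).
Proof.
move=> [f1 f2] [g1 g2]; split.
- have -> : (fun x => complex.Re (a * f x + b * g x)) =
    (fun x => (complex.Re a * complex.Re (f x) + - complex.Im a * complex.Im (f x)) +
      (complex.Re b * complex.Re (g x) + - complex.Im b * complex.Im (g x))).
    by apply/funext => x; rewrite RepD !RepM; ring.
  by apply: L2_realD; apply: L2_realD; apply: L2_realZ.
- have -> : (fun x => complex.Im (a * f x + b * g x)) =
    (fun x => (complex.Re a * complex.Im (f x) + complex.Im a * complex.Re (f x)) +
      (complex.Re b * complex.Im (g x) + complex.Im b * complex.Re (g x))).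
    by apply/funext => x; rewrite ImpD !ImpM; ring.
  by apply: L2_realD; apply: L2_realD; apply: L2_realZ.
Qed.

Lemma L2_conj (l : R) (f : R -> C) : L2 l f -> L2 l (fun x => (f x)^*%C).
Proof.
move=> [f1 f2]; split.
- by have -> : (fun x => complex.Re (f x)^*%C) = (fun x => complex.Re (f x))
    by apply/funext => x; rewrite Rep_conj.
- have -> : (fun x => complex.Im (f x)^*%C) = (fun x => -1 * complex.Im (f x)).
    by apply/funext => x; rewrite Imp_conj mulN1r.
  exact: L2_realZ.
Qed.

Lemma H2_primitives (l : R) (y y1 y2 : R -> C) : 0 <= l -> H2 l y y1 y2 ->
  Cprimitive l y y1 /\ Cprimitive l y1 y2.
Proof.
move=> l0 [Hy Hy1 [L1 L2']].
have p1 : Cprimitive l y1 y2.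
  split; split; try exact: L2_real_integrable.
  - by move=> x xl; rewrite Hy1// RepD.
  - by move=> x xl; rewrite Hy1// ImpD.
have [c1 c2] := Ccontinuous_integrable (Cprimitive_continuous l0 p1).
split=> //; split; split=> //.
- by move=> x xl; rewrite Hy// RepD.
- by move=> x xl; rewrite Hy// ImpD.
Qed.

Lemma primitives_H2 (l : R) (y y1 y2 : R -> C) :
  Cprimitive l y y1 -> Cprimitive l y1 y2 -> L2 l y2 -> H2 l y y1 y2.
Proof. by move=> p p1 L; split=> // x xl; exact: Cprimitive_eq xl. Qed.

Lemma H2_conj (l : R) (y y1 y2 : R -> C) : 0 <= l -> H2 l y y1 y2 ->
  H2 l (fun x => (y x)^*%C) (fun x => (y1 x)^*%C) (fun x => (y2 x)^*%C).
Proof.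
move=> l0 h; have [p p1] := H2_primitives l0 h; have [_ _ L] := h.
by apply: primitives_H2; [exact: Cprimitive_conj|exact: Cprimitive_conj|exact: L2_conj].
Qed.

Lemma H2_comb (l : R) (a b : C) (y y1 y2 z z1 z2 : R -> C) : 0 <= l ->
  H2 l y y1 y2 -> H2 l z z1 z2 ->
  H2 l (fun x => a * y x + b * z x) (fun x => a * y1 x + b * z1 x)
       (fun x => a * y2 x + b * z2 x).
Proof.
move=> l0 hy hz.
have [p p1] := H2_primitives l0 hy; have [_ _ Ly] := hy.
have [r r1] := H2_primitives l0 hz; have [_ _ Lz] := hz.
have Z (d : C) f f' : Cprimitive l f f' ->
    Cprimitive l (fun x => d * f x) (fun x => d * f' x).
  move=> pf; have := CprimitiveM l0 (Cprimitive_cst l d) pf.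
  by congr Cprimitive; apply/funext => x; rewrite mul0r add0r.
apply: primitives_H2; last exact: L2_comb.
- exact: CprimitiveD (Z _ _ _ p) (Z _ _ _ r).
- exact: CprimitiveD (Z _ _ _ p1) (Z _ _ _ r1).
Qed.

End SobolevSpace.

(** * Differentiability in a complex parameter *)

Lemma derivable_lin (K : numFieldType) (f g : K -> K) (a b z : K) :
  derivable (f : K^o -> K^o) z 1 -> derivable (g : K^o -> K^o) z 1 ->
  derivable ((fun t => a * f t - b * g t) : K^o -> K^o) z 1.
Proof.
by move=> df dg; apply: derivableB; apply: derivableM;
  [exact: derivable_cst|exact: df|exact: derivable_cst|exact: dg].
Qed.

Lemma derivable_scale (K : numFieldType) (f : K -> K) (a z : K) :
  derivable (f : K^o -> K^o) z 1 -> derivable ((fun t => a * f t) : K^o -> K^o) z 1.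
Proof. by move=> df; apply: derivableM; [exact: derivable_cst|exact: df]. Qed.

Lemma derivable_scale_sub (K : numFieldType) (f : K -> K) (a b z : K) :
  derivable (f : K^o -> K^o) z 1 ->
  derivable ((fun t => a * f t - b) : K^o -> K^o) z 1.
Proof.
move=> df; apply: derivableB; last exact: derivable_cst.
by apply: derivableM; [exact: derivable_cst|exact: df].
Qed.

Lemma derivable_affine (K : numFieldType) (f : K -> K) (a b z : K) :
  derivable (f : K^o -> K^o) z 1 ->
  derivable ((fun t => a + (t - b) * f t) : K^o -> K^o) z 1.
Proof.
move=> df; apply: derivableD; first exact: derivable_cst.
apply: derivableM; [apply: derivableB|exact: df].
  exact: derivable_id.
exact: derivable_cst.
Qed.

Lemma derivable_of_expansion_num (K : numFieldType) (f : K -> K) (z b d M : K) :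
  0 < d -> 0 <= M ->
  (forall w, `|w - z| <= d -> `|f w - f z - (w - z) * b| <= M * `|w - z| ^+ 2) ->
  derivable (f : K^o -> K^o) z 1.
Proof.
move=> d0 M0 H; apply/cvg_ex; exists (b : K^o).
apply/cvgrPdist_le => /= e e0.
have eM : 0 < e / (M + 1) by rewrite divr_gt0// ltr_wpDl.
near=> h.
have h0 : h != 0 by near: h; exact: nbhs_dnbhs_neq.
have hd : `|h| <= d by near: h; exact: dnbhs0_le.
have he : `|h| <= e / (M + 1) by near: h; exact: dnbhs0_le.
have := H (h *: 1 + z); rewrite addrK /GRing.scale /= mulr1 => /(_ hd).
move: (f (h + z) - f z) => u Hu.
have -> : b - h^-1 * u = - (h^-1 * (u - h * b)).
  by rewrite mulrBr mulrA mulVf// mul1r opprB.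
rewrite normrN normrM normfV ler_pdivrMl ?normr_gt0//.
apply: (le_trans Hu); rewrite expr2 mulrA [leLHS]mulrC ler_wpM2l//.
move: he; rewrite ler_pdivlMr ?ltr_wpDl// => he; apply: le_trans he.
by rewrite mulrC ler_wpM2l// lerDl.
Unshelve. all: by end_near. Qed.

(** The hypotheses use the real-valued norm because estimates are carried out in the
    totally ordered field R rather than in the partially ordered R[i]. *)
Lemma derivable_of_expansion (R : realType) (f : R[i] -> R[i]) (z b : R[i]) (d K : R) :
  0 < d -> 0 <= K ->
  (forall w, Normc.normc (w - z) <= d ->
    Normc.normc (f w - f z - (w - z) * b) <= K * Normc.normc (w - z) ^+ 2) ->
  derivable (f : R[i]^o -> R[i]^o) z 1.
Proof.
move=> d0 K0 H.
apply: (@derivable_of_expansion_num _ f z b d%:C%C K%:C%C); rewrite ?ltcR ?lecR//.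
by move=> w; rewrite !normcE lecR => /H; rewrite -rmorphXn -rmorphM lecR.
Qed.

Section DerivableDeterminant.
Context {K : numFieldType}.

Lemma derivable_sum_seq (I : Type) (r : seq I) (F : I -> K -> K) (z : K) :
  (forall i, derivable (F i : K^o -> K^o) z 1) ->
  derivable ((fun t => \sum_(i <- r) F i t) : K^o -> K^o) z 1.
Proof.
move=> dF; elim: r => [|i r IH].
  under eq_fun do rewrite big_nil; exact: derivable_cst.
under eq_fun do rewrite big_cons; apply: derivableD; [exact: dF|exact: IH].
Qed.

Lemma derivable_prod_seq (I : Type) (r : seq I) (F : I -> K -> K) (z : K) :
  (forall i, derivable (F i : K^o -> K^o) z 1) ->
  derivable ((fun t => \prod_(i <- r) F i t) : K^o -> K^o) z 1.
Proof.
move=> dF; elim: r => [|i r IH].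
  under eq_fun do rewrite big_nil; exact: derivable_cst.
under eq_fun do rewrite big_cons; apply: derivableM; [exact: dF|exact: IH].
Qed.

Definition derivable_mx m n (A : K -> 'M[K]_(m, n)) (z : K) : Prop :=
  forall i j, derivable ((fun t => A t i j) : K^o -> K^o) z 1.

Lemma derivable_mx_mull m n p (P : 'M[K]_(m, n)) (A : K -> 'M[K]_(n, p)) (z : K) :
  derivable_mx A z -> derivable_mx (fun t => P *m A t) z.
Proof.
move=> dA i j; under eq_fun do rewrite mxE.
by apply: derivable_sum_seq => k; apply: derivableM => //; exact: derivable_cst.
Qed.

Lemma derivable_mxD m n (A B : K -> 'M[K]_(m, n)) (z : K) :
  derivable_mx A z -> derivable_mx B z -> derivable_mx (fun t => A t + B t) z.
Proof. by move=> dA dB i j; under eq_fun do rewrite mxE; exact: derivableD. Qed.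

Lemma derivable_det n (A : K -> 'M[K]_n) (z : K) : derivable_mx A z ->
  derivable ((fun t => \det (A t)) : K^o -> K^o) z 1.
Proof.
move=> dA; rewrite /determinant; apply: derivable_sum_seq => s.
by apply: derivableM; [exact: derivable_cst|exact: derivable_prod_seq].
Qed.

End DerivableDeterminant.

(** * Solutions on one edge *)

Section EdgeSolutions.
Context {R : realType}.
Notation mu := (@lebesgue_measure R).
Notation C := R[i].
Notation Rep := (@complex.Re R).
Notation Imp := (@complex.Im R).
Notation normc := (@Normc.normc R).

Definition solution (l : R) (q : R -> R) (lambda : C) (y y1 : R -> C) : Prop :=
  exists2 y2, H2 l y y1 y2 & {ae mu, forall x, x \in `[0, l] ->
      - y2 x + (q x)%:C%C * y x = lambda * y x}.

Lemma solution_conj (l : R) (q : R -> R) (lambda : C) (y y1 : R -> C) :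
  0 <= l -> solution l q lambda y y1 ->
  solution l q (lambda^*)%C (fun x => (y x)^*%C) (fun x => (y1 x)^*%C).
Proof.
move=> l0 [y2 h e]; exists (fun x => (y2 x)^*%C); first exact: H2_conj.
apply: ae_imply e => x + xl => /(_ xl) /(congr1 (@conjc R)).
rewrite rmorphD rmorphN !rmorphM /= => <-.
by rewrite oppr0.
Qed.

(** Integrated form of (y z' - y' z)' = (lambda - nu) y z. *)
Lemma lagrange_identity (l : R) (q : R -> R) (lambda nu : C) (y y1 z z1 : R -> C) :
  0 <= l -> solution l q lambda y y1 -> solution l q nu z z1 ->
  forall x, x \in `[0, l] ->
  y x * z1 x - y1 x * z x =
  y 0 * z1 0 - y1 0 * z 0 + (lambda - nu) * Cintegral `[0, x] (fun t => y t * z t).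
Proof.
move=> l0 [y2 hy ey] [z2 hz ez] x xl.
have [py py1] := H2_primitives l0 hy; have [pz pz1] := H2_primitives l0 hz.
have pW := CprimitiveB (CprimitiveM l0 py pz1) (CprimitiveM l0 py1 pz).
have pyz := CprimitiveM l0 py pz.
have iyz := Ccontinuous_integrable (Cprimitive_continuous l0 pyz).
have pI := CprimitiveM l0 (Cprimitive_cst l (lambda - nu)) (Cprimitive_Cintegral l0 iyz).
have := Cprimitive_ae_eq pW pI _ xl.
rewrite Cintegral00 mulr0 subr0 => <-; first by ring.
apply: ae_imply2 ey ez => t + + tl => /(_ tl) ey /(_ tl) ez.
have -> : y2 t = (q t)%:C%C * y t - lambda * y t by rewrite -ey; ring.
have -> : z2 t = (q t)%:C%C * z t - nu * z t by rewrite -ez; ring.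
by ring.
Qed.

(** By continuity y vanishes everywhere, and then so does y'. This is what makes Cauchy
    data a faithful encoding of classes of functions modulo almost everywhere equality. *)
Lemma solution_ae0 (l : R) (q : R -> R) (lambda : C) (y y1 : R -> C) :
  0 < l -> solution l q lambda y y1 ->
  {ae mu, forall x, x \in `[0, l] -> y x = 0} -> y 0 = 0 /\ y1 0 = 0.
Proof.
move=> l0 [y2 hy _] y0; have [[p1 p2] [q1 q2]] := H2_primitives (ltW l0) hy.
have z0 : 0 \in `[0, l] by rewrite in_itv /= lexx ltW.
have r0 x : x \in `[0, l] -> Rep (y x) = 0.
  apply: (primitive_ae0 l0 p1); apply: ae_imply y0 => t + tl => /(_ tl) ->//.
have i0 x : x \in `[0, l] -> Imp (y x) = 0.
  apply: (primitive_ae0 l0 p2); apply: ae_imply y0 => t + tl => /(_ tl) ->//.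
split; apply: complex_ext; rewrite ?r0 ?i0//.
- exact: (primitive_derivative0 l0 p1 q1 r0).
- exact: (primitive_derivative0 l0 p2 q2 i0).
Qed.

Lemma solution_norm0 (l : R) (q : R -> R) (lambda : C) (y y1 : R -> C) :
  0 < l -> solution l q lambda y y1 ->
  Rep (Cintegral `[0, l] (fun t => (y t)^*%C * y t)) <= 0 -> y 0 = 0 /\ y1 0 = 0.
Proof.
move=> l0 sy.
have [y2 hy _] := sy; have [[p1 p2] _] := H2_primitives (ltW l0) hy.
have i1 := continuous_integrable (primitive_continuous (ltW l0) (primitiveM (ltW l0) p1 p1)).
have i2 := continuous_integrable (primitive_continuous (ltW l0) (primitiveM (ltW l0) p2 p2)).
have z0 : 0 \in `[0, l] by rewrite in_itv /= lexx ltW.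
have -> : Rep (Cintegral `[0, l] (fun t => (y t)^*%C * y t)) =
    \int[mu]_(t in `[0, l]) (Rep (y t) * Rep (y t)) +
    \int[mu]_(t in `[0, l]) (Imp (y t) * Imp (y t)).
  rewrite -RintegralD//=; apply: eq_Rintegral => t _.
  by rewrite RepM Rep_conj Imp_conj; ring.
have g1 : 0 <= \int[mu]_(t in `[0, l]) (Rep (y t) * Rep (y t)).
  by apply: Rintegral_ge0 => t _; rewrite -expr2 sqr_ge0.
have g2 : 0 <= \int[mu]_(t in `[0, l]) (Imp (y t) * Imp (y t)).
  by apply: Rintegral_ge0 => t _; rewrite -expr2 sqr_ge0.
move=> le0; have /eqP := le_anti (introT andP (conj le0 (addr_ge0 g1 g2))).
rewrite paddr_eq0// => /andP[/eqP e1 /eqP e2].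
apply: (solution_ae0 l0 sy); apply: nearW => x xl.
apply: complex_ext.
  exact: primitive_int_sqr0 l0 p1 e1 _ xl.
exact: primitive_int_sqr0 l0 p2 e2 _ xl.
Qed.

Lemma solution_norm_ge0 (l : R) (y : R -> C) :
  0 <= Rep (Cintegral `[0, l] (fun t => (y t)^*%C * y t)).
Proof.
apply: Rintegral_ge0 => t _; rewrite RepM Rep_conj Imp_conj.
by rewrite mulNr opprK addr_ge0// -expr2 sqr_ge0.
Qed.

Section FundamentalSystem.
Variables (l : R) (q : R -> R) (c c1 s s1 : C -> R -> C).
Hypothesis l0 : 0 < l.
Hypothesis hc : forall lambda, ivp_solution l q lambda 1 0 (c lambda) (c1 lambda).
Hypothesis hs : forall lambda, ivp_solution l q lambda 0 1 (s lambda) (s1 lambda).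

Let l0' := ltW l0.
Let sc lambda : solution l q lambda (c lambda) (c1 lambda).
Proof. by case: (hc lambda). Qed.
Let ss lambda : solution l q lambda (s lambda) (s1 lambda).
Proof. by case: (hs lambda). Qed.

Let c0E lambda : c lambda 0 = 1. Proof. by case: (hc lambda). Qed.
Let c10E lambda : c1 lambda 0 = 0. Proof. by case: (hc lambda). Qed.
Let s0E lambda : s lambda 0 = 0. Proof. by case: (hs lambda). Qed.
Let s10E lambda : s1 lambda 0 = 1. Proof. by case: (hs lambda). Qed.

Lemma wronskian_fundamental (lambda : C) (x : R) : x \in `[0, l] ->
  c lambda x * s1 lambda x - c1 lambda x * s lambda x = 1.
Proof.
move=> xl; rewrite (lagrange_identity l0' (sc lambda) (ss lambda) xl).
by rewrite subrr mul0r addr0 c0E c10E s0E s10E; ring.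
Qed.

(** The solution z of - z'' + q z = lambda z + y with zero Cauchy data at 0; [green1] is
    its derivative. *)
Definition green (lambda : C) (y : R -> C) (x : R) : C :=
  c lambda x * Cintegral `[0, x] (fun t => s lambda t * y t) -
  s lambda x * Cintegral `[0, x] (fun t => c lambda t * y t).

Definition green1 (lambda : C) (y : R -> C) (x : R) : C :=
  c1 lambda x * Cintegral `[0, x] (fun t => s lambda t * y t) -
  s1 lambda x * Cintegral `[0, x] (fun t => c lambda t * y t).

(** Variation of parameters, obtained by solving for (y, y') the two Lagrange
    identities with the fundamental system at lambda. *)
Lemma variation_of_parameters (lambda nu : C) (y y1 : R -> C) :
  solution l q nu y y1 -> forall x, x \in `[0, l] ->
  y x = y 0 * c lambda x + y1 0 * s lambda x + (nu - lambda) * green lambda y x /\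
  y1 x = y 0 * c1 lambda x + y1 0 * s1 lambda x + (nu - lambda) * green1 lambda y x.
Proof.
move=> sy x xl.
have Lc := lagrange_identity l0' (sc lambda) sy xl.
have Ls := lagrange_identity l0' (ss lambda) sy xl.
have w := wronskian_fundamental lambda xl.
move: Lc Ls; rewrite c0E c10E s0E s10E /green /green1.
set S := Cintegral _ (fun t => s lambda t * y t).
set K := Cintegral _ (fun t => c lambda t * y t).
move=> Lc Ls.
have e1 : c lambda x * y1 x = c1 lambda x * y x + y1 0 + (lambda - nu) * K.
  by move/eqP: Lc; rewrite subr_eq => /eqP ->; ring.
have e2 : s lambda x * y1 x = s1 lambda x * y x - y 0 + (lambda - nu) * S.
  by move/eqP: Ls; rewrite subr_eq => /eqP ->; ring.
split.
  rewrite -[LHS]mul1r -w.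
  transitivity (c lambda x * (s1 lambda x * y x) - s lambda x * (c1 lambda x * y x)).
    by ring.
  have -> : s1 lambda x * y x = s lambda x * y1 x + y 0 - (lambda - nu) * S.
    by rewrite e2; ring.
  have -> : c1 lambda x * y x = c lambda x * y1 x - y1 0 - (lambda - nu) * K.
    by rewrite e1; ring.
  by ring.
rewrite -[LHS]mul1r -w.
transitivity (s1 lambda x * (c lambda x * y1 x) - c1 lambda x * (s lambda x * y1 x)).
  by ring.
by rewrite e1 e2; ring.
Qed.

Lemma solution_fundamental (lambda : C) (y y1 : R -> C) :
  solution l q lambda y y1 -> forall x, x \in `[0, l] ->
  y x = y 0 * c lambda x + y1 0 * s lambda x /\
  y1 x = y 0 * c1 lambda x + y1 0 * s1 lambda x.
Proof.
move=> sy x xl; have [-> ->] := variation_of_parameters lambda sy xl.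
by rewrite subrr !mul0r !addr0.
Qed.

Lemma solution_continuous (lambda : C) (y y1 : R -> C) :
  solution l q lambda y y1 -> Ccontinuous l y.
Proof.
by move=> [y2 hy _]; have [p _] := H2_primitives l0' hy; exact: Cprimitive_continuous p.
Qed.

Lemma solution_comb (lambda a b : C) :
  solution l q lambda (fun x => a * c lambda x + b * s lambda x)
                      (fun x => a * c1 lambda x + b * s1 lambda x).
Proof.
have [c2 h2c ec] := sc lambda; have [s2 h2s es] := ss lambda.
exists (fun x => a * c2 x + b * s2 x); first exact: H2_comb.
apply: ae_imply2 ec es => t + + tl => /(_ tl) ec /(_ tl) es.
transitivity (a * (- c2 t + (q t)%:C%C * c lambda t) +
              b * (- s2 t + (q t)%:C%C * s lambda t)); first by ring.
by rewrite ec es; ring.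
Qed.

Lemma green_bound (lambda : C) : exists2 P : R, 0 <= P &
  forall (y : R -> C) (N : R), Ccontinuous l y ->
    (forall x, x \in `[0, l] -> normc (y x) <= N) ->
    forall x, x \in `[0, l] -> normc (green lambda y x) <= P * N.
Proof.
have cc := solution_continuous (sc lambda); have cs := solution_continuous (ss lambda).
have [xc xcl Hc] := Ccontinuous_max l0' cc; have [xs xsl Hs] := Ccontinuous_max l0' cs.
set Mc := normc _ in Hc; set Ms := normc _ in Hs.
have Mc0 : 0 <= Mc := normc_ge0 _; have Ms0 : 0 <= Ms := normc_ge0 _.
exists (Mc * (2 * (l * Ms)) + Ms * (2 * (l * Mc))).
  by rewrite addr_ge0// !mulr_ge0.
move=> y N cy yN x xl.
have bI f M : Ccontinuous l f -> (forall t, t \in `[0, l] -> normc (f t) <= M) ->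
    normc (Cintegral `[0, x] (fun t => f t * y t)) <= 2 * (l * (M * N)).
  move=> cf fM; apply: (Cintegral_bound xl).
    exact/Ccontinuous_integrable/CcontinuousM.
  by move=> t tl; rewrite normcM ler_pM ?normc_ge0 ?fM ?yN.
apply: (le_trans (normcD _ _)); rewrite normcN !normcM mulrDl; apply: lerD.
  have -> : Mc * (2 * (l * Ms)) * N = Mc * (2 * (l * (Ms * N))) by ring.
  by rewrite ler_pM ?normc_ge0 ?Hc ?bI.
have -> : Ms * (2 * (l * Mc)) * N = Ms * (2 * (l * (Mc * N))) by ring.
by rewrite ler_pM ?normc_ge0 ?Hs ?bI.
Qed.

Lemma Cintegral_comb (f y z : R -> C) (a b : C) (x : R) : x \in `[0, l] ->
  Ccontinuous l f -> Ccontinuous l y -> Ccontinuous l z ->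
  Cintegral `[0, x] (fun t => f t * (a * y t + b * z t)) =
  a * Cintegral `[0, x] (fun t => f t * y t) + b * Cintegral `[0, x] (fun t => f t * z t).
Proof.
move=> xl cf cy cz.
have fy := CcontinuousM cf cy; have fz := CcontinuousM cf cz.
have afy := CcontinuousM (Ccontinuous_cst l a) fy.
have bfz := CcontinuousM (Ccontinuous_cst l b) fz.
rewrite -(CintegralZ _ xl (Ccontinuous_integrable fy)).
rewrite -(CintegralZ _ xl (Ccontinuous_integrable fz)).
rewrite -(CintegralD xl (Ccontinuous_integrable afy) (Ccontinuous_integrable bfz)).
by apply: Cintegral_eq => t _; ring.
Qed.

Lemma green_comb (lambda a b : C) (y z : R -> C) (x : R) : x \in `[0, l] ->
  Ccontinuous l y -> Ccontinuous l z ->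
  green lambda (fun t => a * y t + b * z t) x =
    a * green lambda y x + b * green lambda z x /\
  green1 lambda (fun t => a * y t + b * z t) x =
    a * green1 lambda y x + b * green1 lambda z x.
Proof.
move=> xl cy cz.
have cc := solution_continuous (sc lambda); have cs := solution_continuous (ss lambda).
by rewrite /green /green1 !Cintegral_comb//; split; ring.
Qed.

Lemma greenB (lambda : C) (y z : R -> C) : Ccontinuous l y -> Ccontinuous l z ->
  forall x, x \in `[0, l] ->
  green lambda (fun t => y t - z t) x = green lambda y x - green lambda z x.
Proof.
move=> cy cz x xl; have [E _] := green_comb lambda 1 (-1) xl cy cz.
transitivity (green lambda (fun t => 1 * y t + -1 * z t) x); last by rewrite E; ring.
by congr green; apply/funext => t; ring.
Qed.

Section Family.
Variables (Y Y1 : C -> R -> C) (a b : C).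
Hypothesis hY : forall lambda, ivp_solution l q lambda a b (Y lambda) (Y1 lambda).

Let sY lambda : solution l q lambda (Y lambda) (Y1 lambda).
Proof. by case: (hY lambda). Qed.
Let YaE lambda : Y lambda 0 = a. Proof. by case: (hY lambda). Qed.
Let YbE lambda : Y1 lambda 0 = b. Proof. by case: (hY lambda). Qed.

(** The solutions Y lambda have the same Cauchy data for all lambda, so only the
    inhomogeneous term of the variation of parameters distinguishes them. *)
Lemma resolvent_step (lambda nu : C) (x : R) : x \in `[0, l] ->
  Y nu x = Y lambda x + (nu - lambda) * green lambda (Y nu) x.
Proof.
move=> xl; have [-> _] := variation_of_parameters lambda (sY nu) xl.
by have [-> _] := solution_fundamental (sY lambda) xl; rewrite !YaE !YbE.
Qed.

Lemma resolvent_step1 (lambda nu : C) (x : R) : x \in `[0, l] ->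
  Y1 nu x = Y1 lambda x + (nu - lambda) * green1 lambda (Y nu) x.
Proof.
move=> xl; have [_ ->] := variation_of_parameters lambda (sY nu) xl.
by have [_ ->] := solution_fundamental (sY lambda) xl; rewrite !YaE !YbE.
Qed.

(** Y nu = Y lambda + (nu - lambda) G (Y nu) first gives a bound on Y nu that is uniform
    for nu near lambda, and then, inserted into itself, the expansion. *)
Lemma resolvent_expansion (lambda : C) : exists d K : R,
  [/\ 0 < d, 0 <= K & forall nu, normc (nu - lambda) <= d ->
    forall x, x \in `[0, l] ->
    normc (Y nu x - Y lambda x - (nu - lambda) * green lambda (Y lambda) x)
      <= K * normc (nu - lambda) ^+ 2].
Proof.
have [P P0 GP] := green_bound lambda.
have cY nu := solution_continuous (sY nu).
have [x0 x0l H0] := Ccontinuous_max l0' (cY lambda).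
set N0 := normc _ in H0; have N00 : 0 <= N0 := normc_ge0 _.
(* d P <= 1/2, so that (nu - lambda) G (Y nu) can be absorbed by Y nu. *)
pose d := (2 * P + 1)^-1.
have d0 : 0 < d by rewrite invr_gt0; nra.
have dP : d * P <= 2^-1.
  have : d * (2 * P + 1) = 1 by rewrite mulVf//; apply: lt0r_neq0; nra.
  by move: d d0 => d d0 E; nra.
exists d, (P * (P * (2 * N0))); split=> //; first by rewrite !mulr_ge0.
move=> nu; set t := normc _ => td x xl.
have t0 : 0 <= t := normc_ge0 _.
have [xm xml Hm] := Ccontinuous_max l0' (cY nu).
have Nm : normc (Y nu xm) <= 2 * N0.
  have : normc (Y nu xm) <= N0 + t * (P * normc (Y nu xm)).
    rewrite {1}(resolvent_step lambda nu xml).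
    apply: (le_trans (normcD _ _)); apply: lerD; first exact: H0.
    by rewrite normcM; apply: ler_wpM2l => //; exact: GP.
  have : 0 <= normc (Y nu xm) := normc_ge0 _.
  move: (normc _) => n n0 nle.
  have tP : t * P <= 2^-1 by apply: le_trans dP; exact: ler_wpM2r.
  by move: tP nle; rewrite mulrA; move: (t * P) => p p2 nle; nra.
have diff z : z \in `[0, l] -> normc (Y nu z - Y lambda z) <= t * (P * (2 * N0)).
  move=> zl; rewrite {1}(resolvent_step lambda nu zl) addrAC subrr add0r normcM.
  apply: ler_wpM2l => //; apply: GP => // w wl; exact: le_trans (Hm w wl) Nm.
have cD : Ccontinuous l (fun z => Y nu z - Y lambda z).
  have := CcontinuousD (cY nu) (CcontinuousM (Ccontinuous_cst l (-1)) (cY lambda)).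
  by congr Ccontinuous; apply/funext => z; ring.
have -> : Y nu x - Y lambda x - (nu - lambda) * green lambda (Y lambda) x =
    (nu - lambda) * green lambda (fun z => Y nu z - Y lambda z) x.
  by rewrite greenB// {1}(resolvent_step lambda nu xl); ring.
rewrite normcM -/t.
have -> : P * (P * (2 * N0)) * t ^+ 2 = t * (P * (t * (P * (2 * N0)))) by ring.
by apply: ler_wpM2l => //; exact: GP.
Qed.

(** The divided differences of the endpoint values are combinations of such integrals, with
    f one of the fundamental solutions at a fixed parameter. *)
Lemma derivable_pairing (f : R -> C) (lambda : C) : Ccontinuous l f ->
  derivable ((fun nu => Cintegral `[0, l] (fun t => f t * Y nu t)) : C^o -> C^o)
    lambda 1.
Proof.
move=> cf.
have ll : l \in `[0, l] by rewrite in_itv /= lexx l0'.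
have [d [K [d0 K0 H]]] := resolvent_expansion lambda.
have cY nu := solution_continuous (sY nu).
have [xf xfl Hf] := Ccontinuous_max l0' cf.
set M := normc _ in Hf; have M0 : 0 <= M := normc_ge0 _.
have pG : Ccontinuous l (green lambda (Y lambda)).
  have cc := solution_continuous (sc lambda); have cs := solution_continuous (ss lambda).
  have cI g : Ccontinuous l g ->
      Ccontinuous l (fun x => Cintegral `[0, x] (fun t => g t * Y lambda t)).
    move=> cg; apply: (Cprimitive_continuous l0').
    by apply: (Cprimitive_Cintegral l0'); apply/Ccontinuous_integrable/CcontinuousM.
  have := CcontinuousD (CcontinuousM cc (cI _ cs))
    (CcontinuousM (Ccontinuous_cst l (-1)) (CcontinuousM cs (cI _ cc))).
  by congr Ccontinuous; apply/funext => z; rewrite /green; ring.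
have B0 : 0 <= 2 * (l * (M * K)) by rewrite !mulr_ge0.
apply: (@derivable_of_expansion _ _ lambda
  (Cintegral `[0, l] (fun t => f t * green lambda (Y lambda) t))
  d (2 * (l * (M * K)))) => // nu nud.
have cfG := CcontinuousM cf pG; have cfY nu' := CcontinuousM cf (cY nu').
have k1 := CcontinuousM (Ccontinuous_cst l (-1)) (cfY lambda).
have k2 := CcontinuousM (Ccontinuous_cst l (- (nu - lambda))) cfG.
have -> : Cintegral `[0, l] (fun t => f t * Y nu t) -
    Cintegral `[0, l] (fun t => f t * Y lambda t) -
    (nu - lambda) * Cintegral `[0, l] (fun t => f t * green lambda (Y lambda) t) =
    Cintegral `[0, l] (fun t => f t *
      (Y nu t - Y lambda t - (nu - lambda) * green lambda (Y lambda) t)).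
  transitivity (Cintegral `[0, l] (fun t => f t * Y nu t) +
      -1 * Cintegral `[0, l] (fun t => f t * Y lambda t) +
      - (nu - lambda) * Cintegral `[0, l] (fun t => f t * green lambda (Y lambda) t)).
    by ring.
  rewrite -(CintegralZ _ ll (Ccontinuous_integrable (cfY lambda))).
  rewrite -(CintegralZ _ ll (Ccontinuous_integrable cfG)).
  rewrite -(CintegralD ll (Ccontinuous_integrable (cfY nu)) (Ccontinuous_integrable k1)).
  rewrite -(CintegralD ll (Ccontinuous_integrable (CcontinuousD (cfY nu) k1))
    (Ccontinuous_integrable k2)).
  by apply: Cintegral_eq => t _; ring.
have -> : 2 * (l * (M * K)) * normc (nu - lambda) ^+ 2 =
  2 * (l * (M * (K * normc (nu - lambda) ^+ 2))) by ring.
apply: (Cintegral_bound ll).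
  have := CcontinuousD (CcontinuousD (cfY nu) k1) k2.
  move=> /Ccontinuous_integrable; congr Cintegrable; apply/funext => z; ring.
by move=> t tl; rewrite normcM ler_pM ?normc_ge0 ?Hf ?H.
Qed.

Lemma derivable_green (lambda nu : C) :
  derivable ((fun z => green lambda (Y z) l) : C^o -> C^o) nu 1 /\
  derivable ((fun z => green1 lambda (Y z) l) : C^o -> C^o) nu 1.
Proof.
have ds := derivable_pairing (lambda := nu) (solution_continuous (ss lambda)).
have dc := derivable_pairing (lambda := nu) (solution_continuous (sc lambda)).
split.
- exact: (derivable_lin (a := c lambda l) (b := s lambda l) ds dc).
- exact: (derivable_lin (a := c1 lambda l) (b := s1 lambda l) ds dc).
Qed.

Lemma derivable_endpoint (nu : C) :
  derivable ((fun z => Y z l) : C^o -> C^o) nu 1 /\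
  derivable ((fun z => Y1 z l) : C^o -> C^o) nu 1.
Proof.
have ll : l \in `[0, l] by rewrite in_itv /= lexx l0'.
have [d0 d1] := derivable_green nu nu.
have E0 : (fun z => Y z l) = (fun z => Y nu l + (z - nu) * green nu (Y z) l).
  by apply/funext => z; exact: resolvent_step.
have E1 : (fun z => Y1 z l) = (fun z => Y1 nu l + (z - nu) * green1 nu (Y z) l).
  by apply/funext => z; exact: resolvent_step1.
rewrite E0 E1; split.
- exact: (derivable_affine (a := Y nu l) (b := nu) d0).
- exact: (derivable_affine (a := Y1 nu l) (b := nu) d1).
Qed.

End Family.

(** The conjugates solve the same equation with the same real Cauchy data. *)
Lemma fundamental_real (lambda : C) (x : R) : (lambda^*)%C = lambda -> x \in `[0, l] ->
  [/\ (c lambda x)^*%C = c lambda x, (c1 lambda x)^*%C = c1 lambda x,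
      (s lambda x)^*%C = s lambda x & (s1 lambda x)^*%C = s1 lambda x].
Proof.
move=> lr xl.
have := solution_conj l0' (sc lambda); rewrite lr => /solution_fundamental /(_ x xl)[-> ->].
have := solution_conj l0' (ss lambda); rewrite lr => /solution_fundamental /(_ x xl)[-> ->].
by rewrite c0E c10E s0E s10E !rmorph1 !rmorph0 !mul1r !mul0r !addr0 !add0r.
Qed.

(** Lagrange's identity between the conjugate of y and z = [green lambda y], which is the
    derivative in lambda of the solution with the Cauchy data of y. *)
Lemma green_bracket (lambda a b : C) : (lambda^*)%C = lambda ->
  let y x := a * c lambda x + b * s lambda x in
  let y1 x := a * c1 lambda x + b * s1 lambda x in
  (y l)^*%C * green1 lambda y l - (y1 l)^*%C * green lambda y l =
  - Cintegral `[0, l] (fun t => (y t)^*%C * y t).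
Proof.
move=> lr y y1.
have ll : l \in `[0, l] by rewrite in_itv /= lexx l0'.
have cc := solution_continuous (sc lambda); have cs := solution_continuous (ss lambda).
have cy : Ccontinuous l y := solution_continuous (solution_comb lambda a b).
have conjyE x : x \in `[0, l] ->
    (y x)^*%C = (a^*)%C * c lambda x + (b^*)%C * s lambda x.
  move=> xl; have [e1 _ e2 _] := fundamental_real lr xl.
  by rewrite /y rmorphD !rmorphM /= e1 e2.
have conjy1E : (y1 l)^*%C = (a^*)%C * c1 lambda l + (b^*)%C * s1 lambda l.
  by have [_ e1 _ e2] := fundamental_real lr ll; rewrite /y1 rmorphD !rmorphM /= e1 e2.
have -> : Cintegral `[0, l] (fun t => (y t)^*%C * y t) =
    (a^*)%C * Cintegral `[0, l] (fun t => c lambda t * y t) +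
    (b^*)%C * Cintegral `[0, l] (fun t => s lambda t * y t).
  rewrite -(CintegralZ _ ll (Ccontinuous_integrable (CcontinuousM cc cy))).
  rewrite -(CintegralZ _ ll (Ccontinuous_integrable (CcontinuousM cs cy))).
  have k1 := CcontinuousM (Ccontinuous_cst l (a^*)%C) (CcontinuousM cc cy).
  have k2 := CcontinuousM (Ccontinuous_cst l (b^*)%C) (CcontinuousM cs cy).
  rewrite -(CintegralD ll (Ccontinuous_integrable k1) (Ccontinuous_integrable k2)).
  by apply: Cintegral_eq => t tl; rewrite conjyE//; ring.
rewrite conjyE// conjy1E /green /green1.
set S := Cintegral _ (fun t => s lambda t * y t).
set K := Cintegral _ (fun t => c lambda t * y t).
have w := wronskian_fundamental lambda ll.
transitivity (- ((c lambda l * s1 lambda l - c1 lambda l * s lambda l) *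
  ((a^*)%C * K + (b^*)%C * S))); first by ring.
by rewrite w mul1r.
Qed.

End FundamentalSystem.
End EdgeSolutions.

(** * Matrix functions without Jordan chains *)

Section NoJordanChain.
Context {K : fieldType} {N : nat}.
Variables (A A1 : K -> 'M[K]_N) (z0 : K).
Hypothesis A_expand : forall z, A z = A z0 + (z - z0) *: A1 z.
Hypothesis no_chain : forall v w : 'rV[K]_N,
  v *m A z0 = 0 -> v *m A1 z0 + w *m A z0 = 0 -> v = 0.

Let r := \rank (A z0).
Let P := invmx (col_ebase (A z0)).

Let P_unit : P \in unitmx.
Proof. by rewrite unitmx_inv col_ebase_unit. Qed.

Let PA0 : P *m A z0 = pid_mx r *m row_ebase (A z0).
Proof. by rewrite /P -{2}(mulmx_ebase (A z0)) !mulmxA mulVmx ?col_ebase_unit// mul1mx. Qed.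

(** The rows of [P *m A z] with index at least r vanish at z0; they are replaced by their
    quotients by z - z0. *)
Definition deflated (z : K) : 'M[K]_N :=
  pid_mx r *m (P *m A z) + copid_mx r *m (P *m A1 z).

Let copid_PA0 : copid_mx r *m (P *m A z0) = 0.
Proof. by rewrite PA0 mulmxA mul_copid_mx_pid ?mul0mx// rank_leq_row. Qed.

Lemma deflated_factor (z : K) :
  (pid_mx r + (z - z0) *: copid_mx r) *m deflated z = P *m A z.
Proof.
have rN : (r <= N)%N by exact: rank_leq_row.
have -> : (pid_mx r + (z - z0) *: copid_mx r) *m deflated z =
    pid_mx r *m (P *m A z) + (z - z0) *: (copid_mx r *m (P *m A1 z)).
  rewrite /deflated mulmxDl !mulmxDr -!scalemxAl !mulmxA.
  rewrite pid_mx_id ?mul_pid_mx_copid ?mul_copid_mx_pid ?copid_mx_id//.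
  by rewrite !mul0mx addr0 scaler0 add0r.
have -> : (z - z0) *: (copid_mx r *m (P *m A1 z)) = copid_mx r *m (P *m A z).
  by rewrite [in RHS]A_expand mulmxDr mulmxDr copid_PA0 add0r -!scalemxAr.
by rewrite -mulmxDl /copid_mx addrC subrK mul1mx.
Qed.

Lemma det_pid_copid (t : K) :
  \det (pid_mx r + t *: copid_mx r : 'M[K]_N) = t ^+ (N - r).
Proof.
have rN : (r <= N)%N by exact: rank_leq_row.
have -> : pid_mx r + t *: copid_mx r =
    diag_mx (\row_(i < N) (if (i < r)%N then 1 else t)) :> 'M[K]_N.
  apply/matrixP => i j; rewrite !mxE; case: (eqVneq i j) => [->|ij] /=; rewrite ?eqxx.
    by case: ifP => _ /=; rewrite ?mulr1n ?eqxx /=; ring.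
  have -> : (i == j :> nat) = false by exact/negbTE.
  by rewrite /= mulr0n; ring.
rewrite det_diag; under eq_bigr do rewrite mxE.
rewrite -(big_mkord xpredT (fun i => if (i < r)%N then 1 else t)).
rewrite (big_cat_nat (n := r))//= big_nat big1 ?mul1r; last by move=> i /andP[_ ->].
rewrite (@eq_big_nat _ _ _ _ _ _ (fun=> t)) ?prodr_const_nat//.
by move=> i /andP[ri _]; rewrite ltnNge ri.
Qed.

Lemma det_factor (z : K) :
  \det (A z) = (z - z0) ^+ (N - r) * ((\det P)^-1 * \det (deflated z)).
Proof.
have /(congr1 determinant) := deflated_factor z.
rewrite !det_mulmx det_pid_copid => E.
have dP : \det P != 0 by rewrite -unitfE -unitmxE.
by apply: (mulfI dP); rewrite -E mulrCA mulVKf//.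
Qed.

(** A vector x in the left kernel of [deflated z0] splits into a chain: its last N - r
    coordinates give v, its first r coordinates give w. *)
Lemma deflated_unit : \det P != 0 /\ \det (deflated z0) != 0.
Proof.
have rN : (r <= N)%N by exact: rank_leq_row.
split; first by rewrite -unitfE -unitmxE.
apply/negP => /det0P[x x0 xB]; case/negP: x0; apply/eqP.
pose v := x *m copid_mx r *m P; pose w := x *m (pid_mx r : 'M[K]_N) *m P.
have vw : v *m A1 z0 + w *m A z0 = 0.
  by rewrite -xB /deflated mulmxDr /v /w !mulmxA addrC.
have v0 : v *m A z0 = 0 by rewrite /v -!mulmxA copid_PA0 mulmx0.
have vE := no_chain v0 vw.
have xc : x *m copid_mx r = 0 by rewrite -[LHS](mulmxK P_unit) -/v vE mul0mx.
have xp : x *m (pid_mx r : 'M[K]_N) = 0.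
  move: vw; rewrite vE mul0mx add0r /w -mulmxA PA0 mulmxA.
  have pp : (pid_mx r : 'M[K]_N) *m pid_mx r = pid_mx r :> 'M[K]_N by exact: pid_mx_id.
  rewrite -(mulmxA x) pp => E.
  by rewrite -[LHS](mulmxK (row_ebase_unit (A z0))) E mul0mx.
by rewrite -[x]mulmx1 -(subrK (pid_mx r) 1%:M) mulmxDr -/(copid_mx r) xc xp addr0.
Qed.

End NoJordanChain.

(** * Vertex conditions on the tree *)

Section TreeCombinatorics.
Context {V : finType} {n : nat}.
Variable T : rooted_tree V n.
Notation adj := (edge_adj (src T) (tgt T)).

Lemma edge_adjacent (j : 'I_n.+1) : adj (src T j) (tgt T j).
Proof. by apply/existsP; exists j; rewrite !eqxx. Qed.

Lemma tgt_neq_root (j : 'I_n.+1) : tgt T j != Defs.root T.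
Proof.
apply/eqP => E; have [_ irr _ _] := tree_edges T.
have := @away_from_root _ _ T j [::] isT isT (esym E); rewrite inE => /eqP sE.
by have := edge_adjacent j; rewrite sE -E irr.
Qed.

Lemma simple_path_to (v : V) : v != Defs.root T -> exists p,
  [/\ path adj (Defs.root T) (rcons p v), uniq (Defs.root T :: rcons p v) &
      adj (last (Defs.root T) p) v].
Proof.
move=> vr; have [_ _ conn _] := tree_edges T.
have /connectP[p0 pp0 E] := conn (Defs.root T) v; rewrite E in vr *.
move: vr; case/shortenP: pp0 {E} => p pp up _ vr.
case/lastP: p pp up vr => [|p w]; first by rewrite /= eqxx.
rewrite last_rcons => pp up _; exists p; split=> //.
by move: pp; rewrite rcons_path => /andP[].
Qed.

(** If the last edge of the simple path to v were directed away from v, then v would lie on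
    the simple path to its other end. *)
Lemma incoming_edge (v : V) : v != Defs.root T -> exists j, tgt T j = v.
Proof.
move=> /simple_path_to[p [pp up /existsP[j]]].
case/orP=> /andP[/eqP sj /eqP tj]; first by exists j.
move: pp; rewrite rcons_path => /andP[pp _].
have up' : uniq (Defs.root T :: p) by move: up; rewrite -rcons_cons rcons_uniq => /andP[].
have := away_from_root pp up' (esym tj); rewrite sj => vin.
by move: up; rewrite -rcons_cons rcons_uniq vin.
Qed.

(** A second edge into v would close a cycle with the simple path to v. *)
Lemma src_last (j : 'I_n.+1) (p : seq V) :
  path adj (Defs.root T) (rcons p (tgt T j)) -> uniq (Defs.root T :: rcons p (tgt T j)) ->
  src T j = last (Defs.root T) p.
Proof.
have [symm irr _ nocyc] := tree_edges T.
move=> pp up; have := away_from_root pp up (last_rcons _ _ _).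
rewrite -rcons_cons mem_rcons in_cons => /orP[/eqP E|win].
  by have := edge_adjacent j; rewrite E irr.
apply/eqP; apply: contraT => wu.
case/splitPl: p / win pp up wu => p1 p2 E.
rewrite rcons_cat cat_path E -cat_cons cat_uniq last_cat E => /andP[_ pp2].
case/and3P=> _ disj up2 wu.
have [] := negP (nocyc (src T j :: rcons p2 (tgt T j)) _ _).
- by case: p2 wu {pp2 disj up2} => [|z p2] /=; rewrite ?eqxx// size_rcons.
- by rewrite /= rcons_path pp2 last_rcons symm edge_adjacent.
rewrite /= up2 andbT; apply: contra disj => win; apply/hasP.
by exists (src T j) => //; rewrite -E mem_last.
Qed.

Lemma tgt_inj : injective (tgt T).
Proof.
move=> j k E.
have [p [pp up _]] := simple_path_to (tgt_neq_root j).
have sj := src_last pp up.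
rewrite E in pp up; have sk := src_last pp up.
by apply: (@no_parallel_edges _ _ T); rewrite sj sk E.
Qed.

Lemma src_ord0 : src T ord0 = Defs.root T.
Proof.
apply/eqP; rewrite root_edges_first card_gt0; apply/set0Pn.
have [p [pp _ _]] := simple_path_to (tgt_neq_root ord0).
by case: p pp => [|u p] /= /andP[a _]; eexists; rewrite inE; exact: a.
Qed.

(** An edge that does not start at the root continues exactly one other edge, and an edge
    that starts at the root continues none. *)
Lemma sum_edges_by_source (K : zmodType) (F : 'I_n.+1 -> K) :
  \sum_j \sum_(k | src T k == tgt T j) F k = \sum_(k | src T k != Defs.root T) F k.
Proof.
under eq_bigr do rewrite big_mkcond /=.
rewrite exchange_big /= [RHS]big_mkcond /=; apply: eq_bigr => k _.
case: ifPn => [kr|/negPn/eqP kr]; last first.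
  rewrite big1// => j _; rewrite kr eq_sym ifF//; exact/negbTE/tgt_neq_root.
have [j0 Ej0] := incoming_edge kr.
rewrite (bigD1 j0)//= Ej0 eqxx big1 ?addr0// => j jj0.
by rewrite -Ej0 (inj_eq tgt_inj) eq_sym (negPf jj0).
Qed.

Lemma sum_incoming (K : zmodType) (F : 'I_n.+1 -> K) (j : 'I_n.+1) (v : V) :
  tgt T j = v -> \sum_(i | tgt T i == v) F i = F j.
Proof.
move=> <-; rewrite (bigD1 j)//= big1 ?addr0// => i /andP[/eqP E].
by rewrite (tgt_inj E) eqxx.
Qed.

Section BoundaryData.
Context {K : comNzRingType}.

(** The standard conditions, for edge functions with values A, E and derivatives
    B, F at the initial and at the final vertices of the edges. *)
Definition vertex_conditions (A B E F : 'I_n.+1 -> K) : Prop :=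
  [/\ forall k, src T k = Defs.root T -> A ord0 = A k,
      \sum_(k | src T k == Defs.root T) B k = 0,
      forall j k, src T k = tgt T j -> E j = A k &
      forall j, F j = \sum_(k | src T k == tgt T j) B k].

(** At each vertex the boundary form of the incoming edge equals the sum of the forms of
    the outgoing edges, and at the root the latter sum vanishes. *)
Lemma green_boundary (A B E F A' B' E' F' : 'I_n.+1 -> K) :
  vertex_conditions A B E F -> vertex_conditions A' B' E' F' ->
  \sum_j (E j * F' j - F j * E' j) = \sum_j (A j * B' j - B j * A' j).
Proof.
move=> [c1 c2 c3 c4] [c1' c2' c3' c4'].
transitivity (\sum_j \sum_(k | src T k == tgt T j) (A k * B' k - B k * A' k)).
  apply: eq_bigr => j _; rewrite c4 c4' mulr_sumr mulr_suml -sumrB.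
  by apply: eq_bigr => k /eqP kj; rewrite (c3 _ _ kj) (c3' _ _ kj).
rewrite sum_edges_by_source [RHS](bigID (fun k => src T k == Defs.root T)) /=.
suff -> : \sum_(k | src T k == Defs.root T) (A k * B' k - B k * A' k) = 0.
  by rewrite add0r.
transitivity (\sum_(k | src T k == Defs.root T) (A ord0 * B' k - B k * A' ord0)).
  by apply: eq_bigr => k /eqP kr; rewrite -(c1 _ kr) -(c1' _ kr).
by rewrite sumrB -mulr_sumr -mulr_suml c2 c2' mulr0 mul0r subrr.
Qed.

(** The left-hand sides of the vertex conditions, in the order of the rows of the
    characteristic matrix. *)
Definition residual (A B E F : 'I_n.+1 -> K) : 'rV[K]_(n.+1 + n.+1) :=
  row_mx
    (\row_k if src T k == Defs.root T then
               if k == ord0 then \sum_(j | src T j == Defs.root T) B j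
               else A ord0 - A k
             else \sum_(j | tgt T j == src T k) E j - A k)
    (\row_i (F i - \sum_(j | src T j == tgt T i) B j)).

Lemma residual_eq0 (A B E F : 'I_n.+1 -> K) :
  residual A B E F = 0 <-> vertex_conditions A B E F.
Proof.
split=> [/eqP|[c1 c2 c3 c4]].
  rewrite row_mx_eq0 => /andP[/eqP/rowP U /eqP/rowP L]; split.
  - move=> k /eqP kr; have := U k; rewrite !mxE kr; case: eqP => [->//|_] /eqP.
    by rewrite subr_eq0 => /eqP.
  - by have := U ord0; rewrite !mxE src_ord0 !eqxx.
  - move=> j k kj; have := U k; rewrite !mxE kj (negPf (tgt_neq_root j)).
    by rewrite (sum_incoming _ (erefl (tgt T j))) => /eqP; rewrite subr_eq0 => /eqP.
  - by move=> i; have := L i; rewrite !mxE => /eqP; rewrite subr_eq0 => /eqP.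
apply/eqP; rewrite row_mx_eq0; apply/andP; split; apply/eqP/rowP => k; rewrite !mxE.
  case: ifPn => [/eqP kr|kr].
    by case: eqP => _; rewrite ?c2// (c1 _ kr) subrr.
  have [j Ej] := incoming_edge kr.
  by rewrite (sum_incoming _ Ej) (c3 j k (esym Ej)) subrr.
by rewrite c4 subrr.
Qed.

(** The entries that do not depend on lambda carry the factor e. For e = 1 this is the
    characteristic matrix, expressed by the endpoint values of the fundamental solutions;
    for e = 0, with divided differences of these values, its divided difference. *)
Definition vertex_mx (e : K) (ec es ec1 es1 : 'I_n.+1 -> K) : 'M[K]_(n.+1 + n.+1) :=
  block_mx
    (\matrix_(k, j) if src T k == Defs.root T then
        if k == ord0 then 0 else e * ((j == ord0)%:R - (j == k)%:R)
      else (tgt T j == src T k)%:R * ec j - e * (j == k)%:R)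
    (\matrix_(k, j) if src T k == Defs.root T then
        if k == ord0 then e * (src T j == Defs.root T)%:R else 0
      else (tgt T j == src T k)%:R * es j)
    (\matrix_(i, j) ((j == i)%:R * ec1 j))
    (\matrix_(i, j) ((j == i)%:R * es1 j - e * (src T j == tgt T i)%:R)).

Let sum_indicator (P : pred 'I_n.+1) (x : 'I_n.+1 -> K) :
  \sum_j x j * (P j)%:R = \sum_(j | P j) x j.
Proof.
rewrite [RHS]big_mkcond; apply: eq_bigr => j _.
by case: (P j); rewrite ?mulr1 ?mulr0.
Qed.

Let sum_delta (k : 'I_n.+1) (x : 'I_n.+1 -> K) : \sum_j x j * (j == k)%:R = x k.
Proof. by rewrite sum_indicator big_pred1_eq. Qed.

Lemma vertex_mx_apply (e : K) (ec es ec1 es1 a b : 'I_n.+1 -> K) :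
  row_mx (\row_j a j) (\row_j b j) *m (vertex_mx e ec es ec1 es1)^T =
  residual (fun j => e * a j) (fun j => e * b j)
    (fun j => a j * ec j + b j * es j) (fun j => a j * ec1 j + b j * es1 j).
Proof.
rewrite tr_block_mx mul_row_block; congr row_mx; apply/rowP => k; rewrite !mxE.
  under eq_bigr do rewrite !mxE.
  under [X in _ + X]eq_bigr do rewrite !mxE.
  case: ifPn => _; first case: ifPn => _.
  - rewrite big1 ?add0r => [|j _]; last by rewrite mulr0.
    by rewrite -sum_indicator; apply: eq_bigr => j _; ring.
  - rewrite [X in _ + X]big1 ?addr0 => [|j _]; last by rewrite mulr0.
    rewrite -(sum_delta ord0 (fun j => e * a j)) -(sum_delta k (fun j => e * a j)).
    by rewrite -sumrB; apply: eq_bigr => j _; ring.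
  - rewrite -sum_indicator -(sum_delta k (fun j => e * a j)) -sumrB -big_split /=.
    by apply: eq_bigr => j _; ring.
under eq_bigr do rewrite !mxE.
under [X in _ + X]eq_bigr do rewrite !mxE.
rewrite -sum_indicator -(sum_delta k (fun j => a j * ec1 j + b j * es1 j)).
by rewrite -sumrB -big_split /=; apply: eq_bigr => j _; ring.
Qed.

Lemma vertex_mx_expand (t : K) (ec es ec1 es1 dc ds dc1 ds1 : 'I_n.+1 -> K) :
  vertex_mx 1 (fun j => ec j + t * dc j) (fun j => es j + t * ds j)
    (fun j => ec1 j + t * dc1 j) (fun j => es1 j + t * ds1 j) =
  vertex_mx 1 ec es ec1 es1 + t *: vertex_mx 0 dc ds dc1 ds1.
Proof.
rewrite scale_block_mx add_block_mx; congr block_mx; apply/matrixP => k j; rewrite !mxE.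
- by do 2?[case: ifP => _]; ring.
- by do 2?[case: ifP => _]; ring.
- by ring.
- by ring.
Qed.

Lemma residualD (A B E F A' B' E' F' : 'I_n.+1 -> K) :
  residual A B E F + residual A' B' E' F' =
  residual (fun j => A j + A' j) (fun j => B j + B' j)
    (fun j => E j + E' j) (fun j => F j + F' j).
Proof.
rewrite add_row_mx; congr row_mx; apply/rowP => k; rewrite !mxE; last first.
  by rewrite big_split /=; ring.
by do 2?[case: ifP => _]; rewrite ?big_split /=; ring.
Qed.

End BoundaryData.
End TreeCombinatorics.

Lemma derivable_vertex_mx (K : numFieldType) (V : finType) (n : nat)
    (T : rooted_tree V n) (e : K) (ec es ec1 es1 : 'I_n.+1 -> K -> K) (z : K) :
  (forall j, [/\ derivable (ec j : K^o -> K^o) z 1, derivable (es j : K^o -> K^o) z 1,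
     derivable (ec1 j : K^o -> K^o) z 1 & derivable (es1 j : K^o -> K^o) z 1]) ->
  derivable_mx (fun t => (vertex_mx T e (fun j => ec j t) (fun j => es j t)
    (fun j => ec1 j t) (fun j => es1 j t))^T) z.
Proof.
move=> d j k.
case: (split_ordP j) => j' ->; case: (split_ordP k) => k' ->;
  have [d1 d2 d3 d4] := d j'.
- under eq_fun do rewrite mxE block_mxEul mxE.
  case: (src T k' == Defs.root T); last exact: (derivable_scale_sub d1).
  by case: (k' == ord0); exact: derivable_cst.
- under eq_fun do rewrite mxE block_mxEdl mxE.
  exact: (derivable_scale d3).
- under eq_fun do rewrite mxE block_mxEur mxE.
  case: (src T k' == Defs.root T); last exact: (derivable_scale d2).
  by case: (k' == ord0); exact: derivable_cst.
- under eq_fun do rewrite mxE block_mxEdr mxE.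
  exact: (derivable_scale_sub d4).
Qed.

(** * The kernel of the operator and the characteristic matrix *)

Section Kernel.
Context {R : realType} {V : finType} {n : nat}.
Variables (T : rooted_tree V n) (l : R) (q : 'I_n.+1 -> R -> R).
Variables c c1 s s1 : 'I_n.+1 -> R[i] -> R -> R[i].
Hypothesis l0 : 0 < l.
Hypothesis hc : forall j lambda,
  ivp_solution l (q j) lambda 1 0 (c j lambda) (c1 j lambda).
Hypothesis hs : forall j lambda,
  ivp_solution l (q j) lambda 0 1 (s j lambda) (s1 j lambda).
Notation C := R[i].
Notation mu := (@lebesgue_measure R).

Let l0' := ltW l0.
Let ll : l \in `[0, l]. Proof. by rewrite in_itv /= lexx l0'. Qed.
Let z0 : 0 \in `[0, l]. Proof. by rewrite in_itv /= lexx l0'. Qed.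

Lemma ker_LN_solution (lambda : C) (y : 'I_n.+1 -> R -> C) : ker_LN T l q lambda y ->
  exists y1, (forall j, solution l (q j) lambda (y j) (y1 j)) /\
    vertex_conditions T (fun j => y j 0) (fun j => y1 j 0)
      (fun j => y j l) (fun j => y1 j l).
Proof.
move=> [y1 [y2 [hy [r1 r2] hv he]]]; exists y1; split.
  by move=> j; exists (y2 j) => //; exact: he.
split=> //.
- by move=> j k kj; have [e _] := hv _ (tgt_neq_root T j) j erefl; exact: e.
- by move=> j; have [_ ->] := hv _ (tgt_neq_root T j) j erefl.
Qed.

Definition edge_values (a b : 'I_n.+1 -> C) (lambda : C) (j : 'I_n.+1) (x : R) : C :=
  a j * c j lambda x + b j * s j lambda x.

Definition edge_derivatives (a b : 'I_n.+1 -> C) (lambda : C) (j : 'I_n.+1) (x : R) : C :=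
  a j * c1 j lambda x + b j * s1 j lambda x.

Lemma edge_values_solution (a b : 'I_n.+1 -> C) (lambda : C) (j : 'I_n.+1) :
  solution l (q j) lambda (edge_values a b lambda j) (edge_derivatives a b lambda j).
Proof. exact: solution_comb. Qed.

Lemma edge_values0 (a b : 'I_n.+1 -> C) (lambda : C) (j : 'I_n.+1) :
  edge_values a b lambda j 0 = a j /\ edge_derivatives a b lambda j 0 = b j.
Proof.
rewrite /edge_values /edge_derivatives.
have [_ -> ->] := hc j lambda; have [_ -> ->] := hs j lambda.
by rewrite !mulr1 !mulr0 addr0 add0r.
Qed.

Lemma edge_values_ker (a b : 'I_n.+1 -> C) (lambda : C) :
  vertex_conditions T a b (fun j => edge_values a b lambda j l)
    (fun j => edge_derivatives a b lambda j l) ->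
  ker_LN T l q lambda (edge_values a b lambda).
Proof.
move=> [v1 v2 v3 v4].
have /choice[y2 hy2] j : exists f,
    H2 l (edge_values a b lambda j) (edge_derivatives a b lambda j) f /\
    {ae mu, forall x, x \in `[0, l] -> - f x + (q j x)%:C%C *
      edge_values a b lambda j x = lambda * edge_values a b lambda j x}.
  by have [f hf e] := edge_values_solution a b lambda j; exists f.
have e0 j := edge_values0 a b lambda j.
exists (edge_derivatives a b lambda), y2.
split; first by move=> j; case: (hy2 j).
- split; last by under eq_bigr => k _ do rewrite (proj2 (e0 k)).
  by move=> k kr; rewrite !(proj1 (e0 _)); exact: v1.
- move=> v vr j jv; split.
    by move=> k kv; rewrite (proj1 (e0 k)); apply: v3; rewrite jv.
  by under eq_bigr => k _ do rewrite (proj2 (e0 k)); rewrite v4 jv.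
by move=> j; case: (hy2 j).
Qed.

Lemma solutions_norm0 (lambda : C) (y y1 : 'I_n.+1 -> R -> C) :
  (forall j, solution l (q j) lambda (y j) (y1 j)) ->
  \sum_j Cintegral `[0, l] (fun t => (y j t)^*%C * y j t) = 0 ->
  forall j, y j 0 = 0 /\ y1 j 0 = 0.
Proof.
move=> sy /(congr1 (@complex.Re R)) E j.
apply: (solution_norm0 l0 (sy j)).
rewrite (big_morph (@complex.Re R) (@RepD R) (erefl : complex.Re 0 = 0)) in E.
by rewrite (psumr_eq0P (fun i _ => solution_norm_ge0 l (y i)) E).
Qed.

Lemma vertex_conditions_conj (A B E F : 'I_n.+1 -> C) :
  vertex_conditions T A B E F ->
  vertex_conditions T (fun j => (A j)^*%C) (fun j => (B j)^*%C)
    (fun j => (E j)^*%C) (fun j => (F j)^*%C).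
Proof.
move=> [v1 v2 v3 v4]; split.
- by move=> k /v1 ->.
- by rewrite -rmorph_sum v2 rmorph0.
- by move=> j k /v3 ->.
- by move=> j; rewrite v4 rmorph_sum.
Qed.

(** Green's formula for an eigenfunction y and its conjugate shows that
    lambda^* - lambda times the squared norm of y is 0. *)
Lemma eigenvalue_real (lambda : C) : eigenvalue_LN T l q lambda ->
  (lambda^*)%C = lambda.
Proof.
move=> [y ky ny]; have [y1 [sy vc]] := ker_LN_solution ky.
have := green_boundary (vertex_conditions_conj vc) vc.
under eq_bigr do rewrite (lagrange_identity l0' (solution_conj l0' (sy _)) (sy _) ll).
rewrite big_split /= => /(canRL (addKr _)); rewrite addNr -mulr_sumr => /eqP.
rewrite mulf_eq0 => /orP[|/eqP I0]; first by rewrite subr_eq0 => /eqP.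
case: ny => j; apply: nearW => x xl.
have [y00 y10] := solutions_norm0 sy I0 j.
have [-> _] := solution_fundamental l0 (hc j) (hs j) (sy j) xl.
by rewrite y00 y10 !mul0r addr0.
Qed.

(** A row vector lists the Cauchy data (a_1, .., a_g, b_1, .., b_g) of the solutions on the
    edges; the matrices act on it from the right, transposed. *)
Definition coef_a (x : 'rV[C]_(n.+1 + n.+1)) (j : 'I_n.+1) : C := x 0 (lshift _ j).
Definition coef_b (x : 'rV[C]_(n.+1 + n.+1)) (j : 'I_n.+1) : C := x 0 (rshift _ j).

Lemma coefK (x : 'rV[C]_(n.+1 + n.+1)) :
  row_mx (\row_j coef_a x j) (\row_j coef_b x j) = x.
Proof.
rewrite -[RHS]hsubmxK; congr row_mx; apply/rowP => j; rewrite !mxE//.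
Qed.

Definition Phi (lambda : C) : 'M[C]_(n.+1 + n.+1) := PhiN T l c c1 s s1 lambda.

Lemma Phi_vertex_mx (lambda : C) : Phi lambda =
  vertex_mx T 1 (fun j => c j lambda l) (fun j => s j lambda l)
    (fun j => c1 j lambda l) (fun j => s1 j lambda l).
Proof.
congr block_mx; apply/matrixP => k j; rewrite !mxE.
- by do 2?[case: ifP => _]; rewrite ?mul1r.
- by do 2?[case: ifP => _]; rewrite ?mul1r.
- by rewrite mul1r.
Qed.

(** The divided difference (Phi nu - Phi lambda) / (nu - lambda), in a form that makes sense
    for nu = lambda, where it is the derivative of Phi. *)
Definition dPhi (lambda nu : C) : 'M[C]_(n.+1 + n.+1) :=
  vertex_mx T 0
    (fun j => green (c j) (s j) lambda (c j nu) l)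
    (fun j => green (c j) (s j) lambda (s j nu) l)
    (fun j => green1 (c j) (c1 j) (s j) (s1 j) lambda (c j nu) l)
    (fun j => green1 (c j) (c1 j) (s j) (s1 j) lambda (s j nu) l).

Lemma Phi_expand (lambda nu : C) : Phi nu = Phi lambda + (nu - lambda) *: dPhi lambda nu.
Proof.
rewrite !Phi_vertex_mx /dPhi -vertex_mx_expand.
have ec j : c j nu l = c j lambda l + (nu - lambda) * green (c j) (s j) lambda (c j nu) l.
  exact: (resolvent_step l0 (hc j) (hs j) (hc j)).
have es j : s j nu l = s j lambda l + (nu - lambda) * green (c j) (s j) lambda (s j nu) l.
  exact: (resolvent_step l0 (hc j) (hs j) (hs j)).
have ec1 j : c1 j nu l = c1 j lambda l +
    (nu - lambda) * green1 (c j) (c1 j) (s j) (s1 j) lambda (c j nu) l.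
  exact: (resolvent_step1 l0 (hc j) (hs j) (hc j)).
have es1 j : s1 j nu l = s1 j lambda l +
    (nu - lambda) * green1 (c j) (c1 j) (s j) (s1 j) lambda (s j nu) l.
  exact: (resolvent_step1 l0 (hc j) (hs j) (hs j)).
by congr vertex_mx; apply/funext => j.
Qed.

Lemma Phi_apply (lambda : C) (x : 'rV[C]_(n.+1 + n.+1)) :
  x *m (Phi lambda)^T = residual T (coef_a x) (coef_b x)
    (fun j => edge_values (coef_a x) (coef_b x) lambda j l)
    (fun j => edge_derivatives (coef_a x) (coef_b x) lambda j l).
Proof.
rewrite -[in LHS](coefK x) Phi_vertex_mx vertex_mx_apply.
by congr residual; apply/funext => j; rewrite mul1r.
Qed.

Lemma dPhi_apply (lambda : C) (x : 'rV[C]_(n.+1 + n.+1)) :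
  x *m (dPhi lambda lambda)^T = residual T (fun=> 0) (fun=> 0)
    (fun j => green (c j) (s j) lambda (edge_values (coef_a x) (coef_b x) lambda j) l)
    (fun j => green1 (c j) (c1 j) (s j) (s1 j) lambda
       (edge_values (coef_a x) (coef_b x) lambda j) l).
Proof.
rewrite -[in LHS](coefK x) vertex_mx_apply.
have cc j : Ccontinuous l (c j lambda).
  have sy : solution l (q j) lambda (c j lambda) (c1 j lambda) by case: (hc j lambda).
  exact (solution_continuous l0 sy).
have cs j : Ccontinuous l (s j lambda).
  have sy : solution l (q j) lambda (s j lambda) (s1 j lambda) by case: (hs j lambda).
  exact (solution_continuous l0 sy).
have G j := green_comb (c1 := c1 j) (s1 := s1 j) l0 (hc j) (hs j) lambda
  (coef_a x j) (coef_b x j) ll (cc j) (cs j).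
congr residual; apply/funext => j; rewrite ?mul0r//.
  exact: esym (proj1 (G j)).
exact: esym (proj2 (G j)).
Qed.

(** The chain gives an edge function z in the domain with (L_N - lambda) z = y, where y has
    the Cauchy data v. Pairing with y and applying Green's formula, y has norm 0. *)
Lemma no_jordan_chain (lambda : C) (v w : 'rV[C]_(n.+1 + n.+1)) :
  (lambda^*)%C = lambda -> v *m (Phi lambda)^T = 0 ->
  v *m (dPhi lambda lambda)^T + w *m (Phi lambda)^T = 0 -> v = 0.
Proof.
move=> lr; rewrite (Phi_apply lambda v) (Phi_apply lambda w) dPhi_apply residualD.
move=> /residual_eq0 vv /residual_eq0 vz.
have := green_boundary (vertex_conditions_conj vv) vz.
set a := coef_a v; set b := coef_b v; set a' := coef_a w; set b' := coef_b w.
have E j : (edge_values a b lambda j l)^*%C *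
      (green1 (c j) (c1 j) (s j) (s1 j) lambda (edge_values a b lambda j) l +
        edge_derivatives a' b' lambda j l) -
    (edge_derivatives a b lambda j l)^*%C *
      (green (c j) (s j) lambda (edge_values a b lambda j) l +
        edge_values a' b' lambda j l) =
    ((a j)^*%C * (0 + b' j) - (b j)^*%C * (0 + a' j)) -
      Cintegral `[0, l] (fun t => (edge_values a b lambda j t)^*%C *
        edge_values a b lambda j t).
  rewrite -(green_bracket l0 (hc j) (hs j) (a j) (b j) lr).
  have sv := solution_conj l0' (edge_values_solution a b lambda j).
  have := lagrange_identity l0' sv (edge_values_solution a' b' lambda j) ll.
  have [-> ->] := edge_values0 a b lambda j; have [-> ->] := edge_values0 a' b' lambda j.
  rewrite lr subrr mul0r addr0 !add0r => <-.
  by rewrite /edge_values /edge_derivatives; ring.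
rewrite (eq_bigr _ (fun j _ => E j)) sumrB => /eqP.
rewrite subr_eq addrC -subr_eq subrr eq_sym => /eqP I0.
have D j := solutions_norm0 (edge_values_solution a b lambda) I0 j.
rewrite -(coefK v) -[RHS]row_mx0; congr row_mx; apply/rowP => j; rewrite !mxE.
  by have [e _] := D j; rewrite (proj1 (edge_values0 a b lambda j)) in e.
by have [_ e] := D j; rewrite (proj2 (edge_values0 a b lambda j)) in e.
Qed.

(** Cauchy data give an isomorphism from the kernel of L_N - lambda to the left kernel of
    the transposed characteristic matrix. *)
Lemma ker_Phi_multiplicity (lambda : C) :
  eigenvalue_multiplicity T l q lambda (\rank (kermx (Phi lambda)^T)).
Proof.
set K := row_base (kermx (Phi lambda)^T).
have sub_ker (x : 'rV_(n.+1 + n.+1)) : (x <= K)%MS = (x *m (Phi lambda)^T == 0).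
  by rewrite eq_row_base; apply/sub_kermxP/eqP.
pose u (x : 'rV[C]_(n.+1 + n.+1)) := edge_values (coef_a x) (coef_b x) lambda.
have u_comb a j t : \sum_i a i * u (row i K) j t = u ((\row_i a i) *m K) j t.
  rewrite /u /edge_values /coef_a /coef_b !mxE !mulr_suml -big_split /=.
  by apply: eq_bigr => i _; rewrite !mxE; ring.
exists (fun i => u (row i K)); split.
- move=> i; apply: edge_values_ker; apply/residual_eq0; rewrite -Phi_apply.
  by apply/eqP; rewrite -sub_ker row_sub.
- move=> a ae0 i; pose x := (\row_i a i) *m K.
  have x0 : x = 0.
    have d0 j : coef_a x j = 0 /\ coef_b x j = 0.
      have [<- <-] := edge_values0 (coef_a x) (coef_b x) lambda j.
      apply: (solution_ae0 l0 (edge_values_solution _ _ lambda j)).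
      by apply: ae_imply (ae0 j) => t + tl => /(_ tl); rewrite u_comb.
    rewrite -(coefK x) -[RHS]row_mx0; congr row_mx; apply/rowP => j; rewrite !mxE.
      by rewrite (proj1 (d0 j)).
    by rewrite (proj2 (d0 j)).
  have /rowP/(_ i) : \row_i a i = 0.
    by apply: (row_free_inj (row_base_free _)); rewrite mul0mx.
  by rewrite !mxE.
move=> y ky; have [y1 [sy vc]] := ker_LN_solution ky.
have yE j x : x \in `[0, l] ->
    y j x = edge_values (fun j => y j 0) (fun j => y1 j 0) lambda j x /\
    y1 j x = edge_derivatives (fun j => y j 0) (fun j => y1 j 0) lambda j x.
  by move=> xl; exact: (solution_fundamental l0 (hc j) (hs j) (sy j) xl).
pose x : 'rV[C]_(n.+1 + n.+1) := row_mx (\row_j y j 0) (\row_j y1 j 0).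
have xa : coef_a x = (fun j => y j 0).
  by apply/funext => j; rewrite /coef_a row_mxEl mxE.
have xb : coef_b x = (fun j => y1 j 0).
  by apply/funext => j; rewrite /coef_b row_mxEr mxE.
have /submxP[a xE] : (x <= K)%MS.
  rewrite sub_ker Phi_apply xa xb; apply/eqP/residual_eq0.
  case: vc => v1 v2 v3 v4; split=> //.
    by move=> j k jk; rewrite -(proj1 (yE j l ll)); exact: v3.
  by move=> j; rewrite -(proj2 (yE j l ll)).
exists (fun i => a 0 i) => j; apply: nearW => t tl.
have -> : \sum_i a 0 i * u (row i K) j t = u ((\row_i a 0 i) *m K) j t by exact: u_comb.
have -> : \row_i a 0 i = a by apply/rowP => i; rewrite mxE.
by rewrite -xE /u xa xb (proj1 (yE j t tl)).
Qed.

Lemma derivable_Phi (z : C) : derivable_mx (fun t => (Phi t)^T) z.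
Proof.
have -> : (fun t => (Phi t)^T) = (fun t => (vertex_mx T 1 (fun j => c j t l)
    (fun j => s j t l) (fun j => c1 j t l) (fun j => s1 j t l))^T).
  by apply/funext => t; rewrite Phi_vertex_mx.
apply: derivable_vertex_mx => j.
have [d1 d2] := derivable_endpoint l0 (hc j) (hs j) (hc j) z.
have [d3 d4] := derivable_endpoint l0 (hc j) (hs j) (hs j) z.
exact (And4 d1 d3 d2 d4).
Qed.

Lemma derivable_dPhi (lambda z : C) : derivable_mx (fun t => (dPhi lambda t)^T) z.
Proof.
apply: derivable_vertex_mx => j.
have [d1 d2] := derivable_green l0 (hc j) (hs j) (hc j) lambda z.
have [d3 d4] := derivable_green l0 (hc j) (hs j) (hs j) lambda z.
exact (And4 d1 d3 d2 d4).
Qed.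

End Kernel.

Unset Implicit Arguments.

Theorem theorem3p12 (R : realType) (V : finType) (n : nat)
    (T : rooted_tree V n) (l : R) (hl : 0 < l)
    (q : 'I_n.+1 -> R -> R) (hq : forall j, L2_real l (q j))
    (c c1 s s1 : 'I_n.+1 -> R[i] -> R -> R[i])
    (hc : forall j lambda, ivp_solution l (q j) lambda 1 0 (c j lambda) (c1 j lambda))
    (hs : forall j lambda, ivp_solution l (q j) lambda 0 1 (s j lambda) (s1 j lambda))
    (lambda0 : R[i]) (hlambda0 : eigenvalue_LN T l q lambda0) :
  exists m : nat,
    eigenvalue_multiplicity T l q lambda0 m /\
    zero_multiplicity (phiN T l c c1 s s1) lambda0 m.
Proof.
have lr := eigenvalue_real hl hc hs hlambda0.
pose A z := (Phi T l c c1 s s1 z)^T.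
pose A1 z := (dPhi T l c c1 s s1 lambda0 z)^T.
have expand z : A z = A lambda0 + (z - lambda0) *: A1 z.
  by rewrite /A /A1 (Phi_expand T hl hc hs lambda0 z) linearD linearZ.
have chain (v w : 'rV[R[i]]_(n.+1 + n.+1)) : v *m A lambda0 = 0 ->
    v *m A1 lambda0 + w *m A lambda0 = 0 -> v = 0.
  exact: (no_jordan_chain hl hc hs lr).
exists (\rank (kermx (A lambda0))); split; first exact: (ker_Phi_multiplicity T hl hc hs).
rewrite mxrank_ker.
pose P := invmx (col_ebase (A lambda0)).
pose h z := (\det P)^-1 * \det (deflated A A1 lambda0 z).
have dh z : derivable (h : R[i]^o -> R[i]^o) z 1.
  apply: derivable_scale; apply: derivable_det.
  by apply: derivable_mxD; do 2 apply: derivable_mx_mull;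
    [exact: derivable_Phi|exact: derivable_dPhi].
have hE z : phiN T l c c1 s s1 z = (z - lambda0) ^+ (n.+1 + n.+1 - \rank (A lambda0)) * h z.
  by rewrite /phiN -det_tr; exact: (det_factor expand).
have F := nbhs_filter (lambda0 : R[i]^o).
exists h; split; [exact (@nearW _ _ _ F dh)| |exact (@nearW _ _ _ F hE)].
have [dP dB] := deflated_unit chain.
by rewrite mulf_neq0// invr_eq0.
Qed.
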